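(* There is a universal constant $C_*>0$ and a universal constant $C>0$ such that the following holds. Let $q$ be a unimodal probability density on $\mathbb R$ with respect to the Lebesgue measure, and let $F\subset\mathbb R^n$ be nonempty and, viewed as a class of functions on $\{1,\dots,n\}$, VC-subgraph with index $\overline V$. Let $\overline S_{q,F}=\{\mathbf q_{\mathbf g}:\mathbf g\in F\}$. Then $$\overline D(\overline S_{q,F})\le C_*\overline V\big[1+\log_+(n/\overline V)\big]$$ and any $\rho$-estimator $\widehat{\mathbf s}=\mathbf q_{\widehat{\mathbf f}}$ based on a countable and dense subset of $\overline S_{q,F}$ satisfies, for any density $p$ and vector $\mathbf f\in\mathbb R^n$, with $\mathbf s=\mathbf p_{\mathbf f}$, $$\mathbb P_{\mathbf s}\Big[C\,\mathbf h^2(\mathbf p_{\mathbf f},\mathbf q_{\widehat{\mathbf f}})\le\mathbf h^2(\mathbf p_{\mathbf f},\overline S_{q,F})+\overline V\big[1+\log_+(n/\overline V)\big]+\xi\Big]\ge1-e^{-\xi}\quad\text{for all }\xi>0.$$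
   Context: Fixed design regression. Let $n\ge3$. Observations $X_i=f_i+\varepsilon_i$, $1\le i\le n$, are real-valued, with $\mathbf f=(f_1,\dots,f_n)\in\mathbb R^n$ and $\varepsilon_i$ i.i.d. with density $p$ with respect to the Lebesgue measure $\mu$ on $\mathbb R$. For a density $q$ and $\mathbf g\in\mathbb R^n$, $\mathbf q_{\mathbf g}=(q(\cdot-g_1),\dots,q(\cdot-g_n))$; thus $\boldsymbol X=(X_1,\dots,X_n)$ has independent coordinates with densities given by $\mathbf s=\mathbf p_{\mathbf f}$, and $\mathbb P_{\mathbf s},\mathbb E_{\mathbf s}$ refer to this distribution. More generally $\mathcal L_0$ is the set of $n$-tuples $\mathbf t=(t_1,\dots,t_n)$ of probability densities with respect to $\mu$, with $h^2(u,v)=\frac12\int(\sqrt u-\sqrt v)^2d\mu$, $\rho(u,v)=\int\sqrt{uv}\,d\mu$, $\mathbf h^2(\mathbf t,\mathbf t')=\sum_ih^2(t_i,t_i')$, $\mathbf h(\mathbf t,S)=\inf_{\mathbf u\in S}\mathbf h(\mathbf t,\mathbf u)$, and for a general $\mathbf s\in\mathcal L_0$, $\mathbb P_{\mathbf s},\mathbb E_{\mathbf s}$ mean that the $X_i$ are independent with densities $s_i$. $S\subset\mathcal L_0$ is identifiable if $\mathbf h(\mathbf u,\mathbf u')>0$ for distinct $\mathbf u,\mathbf u'\in S$. ''Dense'' is with respect to $\mathbf h$; ''countable'' means finite or countable. Unimodal: non-decreasing then non-increasing. Conventions: $0/0=1$, $x/0=+\infty$ for $x>0$, $\sup\varnothing=0$,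 $\log_+x=\max\{\log x,0\}$. Constants: $c_0=\frac18(1-\frac1{\sqrt2})$, $c_1=2(7+4\sqrt2)$, $c_2=1+\frac1{\sqrt2}$, $\kappa=357$. VC-subgraph: a class $\mathcal F$ of functions on a set $\Xi$ is VC-subgraph with index $\overline V$ if the class of subgraphs $\{(x,u)\in\Xi\times\mathbb R:f(x)>u\}$, $f\in\mathcal F$, has finite VC-index $\overline V$, i.e. $\overline V$ is the smallest integer $m$ such that no set of $m$ points is shattered. $\rho$-estimators. $\psi(u)=\frac{u-1}{\sqrt{1+u^2}}$ for $u\in[0,+\infty)$, $\psi(+\infty)=1$. For $\mathbf t,\mathbf t'\in\mathcal L_0$, $\mathbf r=(\mathbf t+\mathbf t')/2$, $\mathbf T(\boldsymbol X,\mathbf t,\mathbf t')=\frac12\sum_i[\rho(t_i',r_i)-\rho(t_i,r_i)]+\frac1{\sqrt2}\sum_i\psi(\sqrt{t_i'/t_i}(X_i))$. For countable identifiable $S$, $\boldsymbol\Upsilon(S,\mathbf t)=\sup_{\mathbf t'\in S}\mathbf T(\boldsymbol X,\mathbf t,\mathbf t')$, $\mathcal E(\boldsymbol X,S)=\{\mathbf t\in S:\boldsymbol\Upsilon(S,\mathbf t)\le\inf_{\mathbf u\in S}\boldsymbol\Upsilon(S,\mathbf u)+\kappa/10\}$. A $\rho$-estimator based on $S$ is any measurably chosen element of $\{\mathbf t\in\mathcal L_0:\mathbf h(\mathbf t,\mathcal E(\boldsymbol X,S))=0\}$; here it is written $\mathbf q_{\widehat{\mathbf f}}$. Uniform dimension.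 With $\mathbf Z(\boldsymbol X,\mathbf t,\mathbf t')=\sum_i\{\psi(\sqrt{t_i'/t_i}(X_i))-\mathbb E_{\mathbf s}[\psi(\sqrt{t_i'/t_i}(X_i))]\}$, let $\mathbf w^S(\mathbf s,\overline{\mathbf s},y)=\mathbb E_{\mathbf s}[\sup|\mathbf Z(\boldsymbol X,\overline{\mathbf s},\mathbf t)|]$, the supremum over $\mathbf t\in S$ with $\mathbf h^2(\mathbf s,\mathbf t)+\mathbf h^2(\mathbf s,\overline{\mathbf s})\le y^2$; $D^S(\mathbf s,\overline{\mathbf s})=\overline y^2\vee1$ with $\overline y=\sup\{y\ge0:\mathbf w^S(\mathbf s,\overline{\mathbf s},y)>c_0y^2\}$; $\overline D^S=\sup_{\mathbf s,\overline{\mathbf s}\in\mathcal L_0}D^S(\mathbf s,\overline{\mathbf s})$; $\overline D(\overline S)=\inf_S[2c_1\sup_{\mathbf u\in\overline S}\mathbf h^2(\mathbf u,S)+c_2\overline D^S]$ over countable identifiable $S\subset\mathcal L_0$. *)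

(* Defs.v *)
From HB Require Import structures.
From mathcomp Require Import all_boot all_order all_algebra.
From mathcomp Require Import all_classical all_reals all_analysis.
From mathcomp Require Import measurable_realfun.
Set Implicit Arguments.
Unset Strict Implicit.
Unset Printing Implicit Defensive.
Import Order.TTheory GRing.Theory Num.Def Num.Theory.
Import numFieldNormedType.Exports.
Local Open Scope classical_set_scope.
Local Open Scope ring_scope.

Record density (R : realType) := Density {
  pdf :> measurableTypeR R -> R ;
  measurable_pdf : measurable_fun setT pdf ;
  pdf_ge0 : forall x, 0 <= pdf x ;
  integral_pdf : (\int[lebesgue_measure]_x (pdf x)%:E = 1)%E }.

Section law_of_a_density.
Context (R : realType) (q : density R).
Local Notation mu := (@lebesgue_measure R).

Definition density_prob (A : set (measurableTypeR R)) : \bar R :=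
  (\int[mu]_(x in A) (q x)%:E)%E.

Let density_prob0 : density_prob set0 = 0%E.
Proof. by rewrite /density_prob integral_set0. Qed.

Let density_prob_ge0 A : (0 <= density_prob A)%E.
Proof. by apply: integral_ge0 => x _; rewrite lee_fin pdf_ge0. Qed.

Let density_prob_sigma_additive : semi_sigma_additive density_prob.
Proof.
move=> F mF tF mUF; rewrite /density_prob; apply: cvg_toP.
  apply: ereal_nondecreasing_is_cvgn => m n mn.
  apply: lee_sum_nneg_natr => // k _ _.
  by apply: integral_ge0 => x _; rewrite lee_fin pdf_ge0.
rewrite ge0_integral_bigcup//=.
  apply/measurable_EFinP.
  exact: (measurable_funS measurableT (@subsetT _ _) (measurable_pdf q)).
by move=> x _; rewrite lee_fin pdf_ge0.
Qed.

HB.instance Definition _ := isMeasure.Build _ _ _ density_prob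
  density_prob0 density_prob_ge0 density_prob_sigma_additive.

Let density_probT : density_prob [set: _] = 1%E.
Proof. exact: integral_pdf. Qed.

HB.instance Definition _ :=
  @Measure_isProbability.Build _ _ R density_prob density_probT.

End law_of_a_density.

Section translation.
Context (R : realType).
Local Notation mu := (@lebesgue_measure R).

Let shift (a : R) : measurableTypeR R -> measurableTypeR R := fun x => x - a.

Let measurable_shift a : measurable_fun setT (shift a).
Proof. exact: measurable_funB. Qed.

Let lebesgue_measure_shift a (A : set (measurableTypeR R)) : measurable A ->
  pushforward mu (shift a) A = mu A.
Proof.
move=> mA; apply/esym.
apply: (@lebesgue_measure_unique R (pushforward mu (shift a))) => //.
move=> _ [[x y]] _ <-.
have E : shift a @^-1` `]x, y] = `](x + a), (y + a)]%classic.
  by apply/seteqP; split => z; rewrite /preimage/= !in_itv/= ltrBrDr lerBlDr.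
transitivity (mu `](x + a), (y + a)]%classic); last by rewrite -E.
rewrite /= !lebesgue_measure_itv/= !lte_fin ltrD2r; case: ifPn => // _.
by rewrite -!EFinD opprD addrACA subrr addr0.
Qed.

Definition translate (q : density R) (a : R) : density R.
Proof.
refine (@Density R (fun x => q (shift a x)) _ _ _).
- exact: measurableT_comp (measurable_pdf q) (measurable_shift a).
- by move=> x; exact: pdf_ge0.
- rewrite -(integral_pdf q) -[RHS](@eq_measure_integral _ _ _ _ mu (pushforward mu (shift a))).
  + rewrite ge0_integral_pushforward ?preimage_setT//.
    * by apply: measurableT_comp => //; exact: measurable_pdf.
    * by move=> x _; rewrite lee_fin pdf_ge0.
  + by move=> A mA _; exact: lebesgue_measure_shift.
Defined.

Lemma translateE (q : density R) a x : translate q a x = q (x - a).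
Proof. by []. Qed.

End translation.

Section product_law.
Context (R : realType).
Local Notation T := (measurableTypeR R).

Definition L0 (n : nat) : Type := 'I_n -> density R.

Definition cons_sample n (z : T * n.-tuple T) : n.+1.-tuple T :=
  [tuple of z.1 :: z.2].

Let measurable_cons_sample n : measurable_fun setT (@cons_sample n).
Proof. exact: measurable_cons. Qed.

HB.instance Definition _ n :=
  isMeasurableFun.Build _ _ _ _ (@cons_sample n) (@measurable_cons_sample n).

(* The joint law, on [R^n], of independent coordinates with densities
   [t ord0, t 1, ...]; see [lawE]. *)
Fixpoint law n : L0 n -> probability (n.-tuple T) R :=
  match n return L0 n -> probability (n.-tuple T) R with
  | 0%N => fun=> \d_[tuple]
  | m.+1 => fun t => distribution
      (density_prob (t ord0) \x law (fun i : 'I_m => t (lift ord0 i)))%E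
      (@cons_sample m)
  end.

Lemma lawE n (t : L0 n) (A : 'I_n -> set T) : (forall i, measurable (A i)) ->
  law t [set x | forall i, A i (tnth x i)] =
  (\prod_(i < n) \int[lebesgue_measure]_(y in A i) (t i y)%:E)%E.
Proof.
elim: n t A => [|n IHn] t A mA.
  rewrite big_ord0 /= (_ : [set x | _] = setT) ?diracT//.
  by apply/seteqP; split => x //= _ [].
rewrite big_ord_recl -IHn//= /distribution /pushforward.
rewrite (_ : _ @^-1` _ = A ord0 `*`
  [set x | forall i : 'I_n, A (lift ord0 i) (tnth x i)]); last first.
  apply/seteqP; split => -[y x]/=.
    move=> H; split; first exact: (H ord0).
    by move=> i; have := H (lift ord0 i); rewrite tnthS.
  move=> [H0 H] i; case: (unliftP ord0 i) => [j ->|-> //].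
  by rewrite tnthS.
rewrite product_measure1E//.
rewrite (_ : [set x | _] = \bigcap_(i : 'I_n)
  ((fun x : n.-tuple T => tnth x i) @^-1` A (lift ord0 i))).
  apply: fin_bigcap_measurable => [|i _]; first exact: finite_finset.
  have := @measurable_tnth _ T n i measurableT _ (mA (lift ord0 i)).
  by rewrite setTI.
by apply/seteqP; split => [x H i _|x H i]; [exact: H|exact: (H i Logic.I)].
Qed.

End product_law.

Section hellinger.
Context (R : realType).
Local Notation mu := (@lebesgue_measure R).
Implicit Types u v : measurableTypeR R -> R.

Definition h2 u v : R :=
  2^-1 * (\int[mu]_x (Num.sqrt (u x) - Num.sqrt (v x)) ^+ 2).

Definition affinity u v : R := \int[mu]_x Num.sqrt (u x * v x).

Variable n : nat.
Implicit Types (t : L0 R n) (S : set (L0 R n)).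

Definition hell2 t t' : R := \sum_(i < n) h2 (t i) (t' i).

Definition hell t t' : R := Num.sqrt (hell2 t t').

(* Extended-real valued, so that the distance to the empty set is [+oo]. *)
Definition hell_dist t S : \bar R := ereal_inf [set (hell t u)%:E | u in S].

Definition identifiable S :=
  forall t t', S t -> S t' -> t <> t' -> 0 < hell t t'.

Definition dense_in S Sbar :=
  S `<=` Sbar /\
  forall t, Sbar t -> forall e : R, 0 < e -> exists2 u, S u & hell t u < e.

End hellinger.

Section rho_estimation.
Context (R : realType).
Local Open Scope ereal_scope.

Definition kappa : R := 357%:R.
Definition c0 : R := (8%:R^-1 * (1 - (Num.sqrt 2)^-1))%R.
Definition c1 : R := (2 * (7%:R + 4%:R * Num.sqrt 2))%R.
Definition c2 : R := (1 + (Num.sqrt 2)^-1)%R.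

(* The quotient [a / b] of nonnegative reals, with 0/0 = 1 and a/0 = +oo. *)
Definition ratio (a b : R) : \bar R :=
  if b == 0%R then (if a == 0%R then 1 else +oo) else (a / b)%:E.

(* [psi] is only meant for arguments in [0, +oo]; its value at -oo is junk. *)
Definition psi (u : \bar R) : R :=
  match u with
  | r%:E => ((r - 1) / Num.sqrt (1 + r ^+ 2))%R
  | +oo => 1%R
  | -oo => 0%R
  end.

(* Supremum of a set of nonnegative extended reals, with sup(set0) = 0. *)
Definition esup0 (A : set \bar R) : \bar R := ereal_sup (0 |` A).

Variable n : nat.
Local Notation sample := (n.-tuple (measurableTypeR R)).
Implicit Types (X : sample) (s t : L0 R n) (S : set (L0 R n)).

Definition psi_sqrt_ratio t t' (i : 'I_n) X : R :=
  psi (sqrte (ratio (t' i (tnth X i)) (t i (tnth X i)))).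

Definition stat_T X t t' : R :=
  (let r i x := ((t i x + t' i x) / 2)%R in
   2^-1 * (\sum_(i < n) (affinity (t' i) (r i) - affinity (t i) (r i)))
   + (Num.sqrt 2)^-1 * (\sum_(i < n) psi_sqrt_ratio t t' i X))%R.

Definition Upsilon X S t : \bar R := ereal_sup [set (stat_T X t t')%:E | t' in S].

Definition near_minimizers X S : set (L0 R n) :=
  [set t | S t /\
     Upsilon X S t <= ereal_inf [set Upsilon X S u | u in S] + (kappa / 10%:R)%:E].

(* Measurability of [shat] is with respect to the sigma-algebra generated by
   the maps [hell t], i.e. by the balls of [hell]; as [hell] is separable this
   is its Borel sigma-algebra. *)
Definition rho_estimator S (shat : sample -> L0 R n) :=
  [/\ countable S, identifiable S,
      forall t, measurable_fun setT (fun X => hell t (shat X)) &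
      forall X, hell_dist (shat X) (near_minimizers X S) = 0].

Definition process_Z s X t t' : R :=
  (\sum_(i < n) (psi_sqrt_ratio t t' i X
                 - fine 'E_(law s)[psi_sqrt_ratio t t' i]))%R.

Definition modulus_w S s sbar (y : R) : \bar R :=
  \int[law s]_X esup0 [set `|process_Z s X sbar t|%:E |
    t in [set t | S t /\ (hell2 s t + hell2 s sbar <= y ^+ 2)%R]].

Definition dimension_at S s sbar : \bar R :=
  let ybar := esup0 [set y%:E |
    y in [set y : R | (0 <= y)%R /\ (c0 * y ^+ 2)%:E < modulus_w S s sbar y]] in
  maxe (ybar ^+ 2) 1.

Definition Dbar_countable S : \bar R :=
  ereal_sup [set dimension_at S z.1 z.2 | z in [set: L0 R n * L0 R n]].

Definition uniform_dim (Sbar : set (L0 R n)) : \bar R :=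
  ereal_inf [set (2 * c1)%:E * esup0 [set hell_dist u S ^+ 2 | u in Sbar]
                 + c2%:E * Dbar_countable S |
             S in [set S | countable S /\ identifiable S]].

End rho_estimation.

Section vc_subgraph.

Definition shattered (T : Type) (C : set (set T)) (A : set T) :=
  forall B, B `<=` A -> exists2 c, C c & c `&` A = B.

Definition vc_index (T : Type) (C : set (set T)) (V : nat) :=
  (forall A, (A #= `I_V)%card -> ~ shattered C A) /\
  (forall m, (forall A, (A #= `I_m)%card -> ~ shattered C A) -> (V <= m)%N).

Definition subgraph (R : realType) (Xi : Type) (f : Xi -> R) : set (Xi * R) :=
  [set z | z.2 < f z.1].

Definition vc_subgraph (R : realType) (Xi : Type) (F : set (Xi -> R)) V :=
  vc_index [set subgraph f | f in F] V.

End vc_subgraph.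

Section regression.
Context (R : realType).

(* The value at the mode [m] is unconstrained, so that densities which are
   unbounded near their mode are allowed. *)
Definition unimodal (q : R -> R) :=
  exists m : R,
    {in `]-oo, m[ &, {homo q : x y / x <= y}} /\
    {in `]m, +oo[ &, {homo q : x y /~ x <= y}}.

Definition log_plus (x : R) : R := Num.max (ln x) 0.

Variable n : nat.

Definition shifts (q : density R) (g : 'rV[R]_n) : L0 R n :=
  fun i => translate q (g ord0 i).

Definition shift_model (q : density R) (F : set 'rV[R]_n) : set (L0 R n) :=
  [set shifts q g | g in F].

Definition as_functions (F : set 'rV[R]_n) : set ('I_n -> R) :=
  [set g ord0 | g in F].

End regression.

(* Main.v *)
Require Import Defs.
From HB Require Import structures.
From mathcomp Require Import all_boot all_order all_algebra.
Set Implicit Arguments.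
Unset Strict Implicit.
Unset Printing Implicit Defensive.
Import Order.TTheory GRing.Theory Num.Def Num.Theory.

(** The scores [psi (sqrt (t_i / sbar_i))], for [t] a translate of [q] by [g],
    depend on each coordinate of [g] through a function that rises and then
    falls, because [q] is unimodal. It is therefore dominated by a monotone
    function of [g_i] of bounded range, whose expectation under [s_i] splits the
    line into about [n / V] cells of small mean oscillation. Which cells the
    coordinates of [g] lie in is a pattern of the subgraph of [g], so by
    Sauer-Shelah only [exp (2 L)] patterns occur, [L = V (1 + log_+ (n / V))].
    This brackets the whole class by few independent sums: Bernstein's
    exponential inequality and a union bound control the supremum of
    [psi]-deviations, self-normalized by their variances, by [exp (3 L)], with
    neither symmetrization nor Talagrand's inequality.

    The expectation of [T(X, t, t')] is at most
    [(1 + 1/sqrt 2) h^2(s, t) - (1 - 1/sqrt 2) h^2(s, t')] and the variances are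
    at most [6 (h^2(s, t) + h^2(s, t'))]. Hence, by Markov's inequality, the
    deviation bound for rho-estimators and, by integration, the bound on the
    modulus [w]; the countable net required in the uniform dimension comes from
    the continuity of the translations of [q] in Hellinger distance. *)

(** * Pajor's lemma *)

Section sauer_shelah.
Context {J : finType}.
Implicit Types (A B S : {set J}) (P : {set {set J}}).

Definition shatters P S :=
  [forall B : {set J}, (B \subset S) ==> [exists A in P, A :&: S == B]].

Lemma shattersP P S : reflect (forall B, B \subset S ->
  exists2 A, A \in P & A :&: S = B) (shatters P S).
Proof.
apply: (iffP forallP) => H B; last first.
  by apply/implyP => /H[A AP <-]; apply/existsP; exists A; rewrite AP eqxx.
by move=> BS; have := H B; rewrite BS => /existsP[A /andP[AP /eqP <-]]; exists A.
Qed.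

Lemma shatters_sub P S S' : S' \subset S -> shatters P S -> shatters P S'.
Proof.
move=> S'S /shattersP PS; apply/shattersP => B BS'.
have [A AP AB] := PS B (subset_trans BS' S'S).
by exists A => //; rewrite -(setIidPr S'S) setIA AB (setIidPl BS').
Qed.

Lemma shatters_subset P P' S : P \subset P' -> shatters P S -> shatters P' S.
Proof.
move=> PP' /shattersP PS; apply/shattersP => B BS.
by have [A AP AB] := PS B BS; exists A => //; exact: (subsetP PP').
Qed.

(* Pajor's form of the Sauer-Shelah lemma. Splitting [P] along a point [x],
   a set shattered by both halves stays shattered by [P] after adding [x]. *)
Lemma card_le_shattered P : #|P| <= #|[set S | shatters P S]|.
Proof.
have [m] := ubnP #|P|; elim: m P => // m IH P; rewrite ltnS => Pm.
have [P1|P2] := leqP #|P| 1.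
  have [->|[A AP]] := set_0Vmem P; first by rewrite cards0.
  rewrite (leq_trans P1)// card_gt0; apply/set0Pn; exists set0.
  rewrite inE; apply/shattersP => B; rewrite subset0 => /eqP ->.
  by exists A => //; rewrite setI0.
have [A1 [A2 [A1P A2P A12]]] : exists A1 A2, [/\ A1 \in P, A2 \in P & A1 != A2].
  have /card_gt1P[A1 [A2 [? ? ?]]] := P2.
  by exists A1, A2.
have [x xA] : exists x, (x \in A1) != (x \in A2).
  apply/existsP; apply: contraR A12; rewrite negb_exists => /forallP H.
  by apply/eqP/setP => x; have := H x; rewrite negbK => /eqP.
pose Q b := [set A in P | (x \in A) == b].
have QP b : Q b \subset P by apply/subsetP => A; rewrite inE => /andP[].
have PQ : #|P| = #|Q true| + #|Q false|.
  rewrite -(cardsID [set A : {set J} | x \in A] P); congr (_ + _)%N.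
    by apply: eq_card => A; rewrite !inE eqb_id.
  by apply: eq_card => A; rewrite !inE eqbF_neg andbC.
have Q0 b : 0 < #|Q b|.
  apply/card_gt0P; exists (if (x \in A1) == b then A1 else A2).
  rewrite inE; case: eqP => [->|]; first by rewrite A1P eqxx.
  move: xA; case: (x \in A1); case: (x \in A2) => //= _; case: b => //= _;
  by rewrite A2P.
have Qm b : #|Q b| < m.
  rewrite (leq_trans _ Pm)// PQ; case: b.
    by rewrite -{1}[#|Q true|]addn0 ltn_add2l.
  by rewrite -{1}[#|Q false|]add0n ltn_add2r.
pose Sh b := [set S | shatters (Q b) S].
have xSh b S : S \in Sh b -> x \notin S.
  rewrite inE => /shattersP QS; apply/negP => xS.
  have bS : (if b then set0 else [set x]) \subset S.
    by case: (b); rewrite ?sub0set ?sub1set.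
  have [A] := QS _ bS.
  rewrite inE => /andP[_ /eqP xb] /setP /(_ x).
  by rewrite !inE xS andbT xb; case: (b); rewrite !inE ?eqxx.
have ShP : [set x |: S | S in Sh true :&: Sh false] :|: (Sh true :|: Sh false)
    \subset [set S | shatters P S].
  apply/subsetP => S /setUP[/imsetP[S' /setIP[S1 S0] ->]|/setUP].
    rewrite inE; apply/shattersP => B BS.
    have xS' := xSh _ _ S1.
    have : S' \in Sh (x \in B) by case: (x \in B).
    rewrite inE => /shattersP/(_ (B :\ x)) [].
      by rewrite subDset.
    move=> A; rewrite inE => /andP[AP /eqP xAB] AS; exists A => //.
    rewrite setIUr AS; apply/setP => y; rewrite !inE.
    by case: eqP => [->|]; rewrite ?xAB ?andbT ?orbF ?andbF.
  by rewrite !inE; case; apply: shatters_subset.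
apply: leq_trans (subset_leq_card ShP).
rewrite cardsU [X in (_ - X)%N](_ : _ = 0%N) ?subn0; last first.
  apply/eqP; rewrite cards_eq0; apply/eqP/setP => S; rewrite in_setI in_set0; apply/negP => /andP[/imsetP[S' _ ->]].
  by move=> /setUP[] /xSh; rewrite !inE eqxx.
rewrite card_in_imset; last first.
  move=> S S'; rewrite !inE => /andP[S1 _] /andP[S'1 _] SS'.
  have xS : x \notin S by apply: (xSh true); rewrite inE.
  have xS' : x \notin S' by apply: (xSh true); rewrite inE.
  by rewrite -(setU1K xS) SS' setU1K.
rewrite addnC cardsU subnK; last by rewrite (leq_trans _ (leq_addr _ _))// subset_leq_card// subsetIl.
by rewrite PQ leq_add// IH.
Qed.

Local Open Scope ring_scope.

(** Expand [(1 + x) ^+ #|J|] as the sum of [x ^+ #|S|] over all subsets and keep those with at most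
    [V] elements, each contributing at least [x ^+ V] since [x <= 1]. *)
Lemma card_small_sets_le (R : realFieldType) (V : nat) (x : R) :
  0 < x -> x <= 1 ->
  #|[set S : {set J} | (#|S| <= V)%N]|%:R * x ^+ V <= (1 + x) ^+ #|J|.
Proof.
move=> x0 x1.
have -> : (1 + x) ^+ #|J| = \sum_(S : {set J}) x ^+ #|S|.
  have -> : (1 + x) ^+ #|J| = \prod_(j : J) (x + 1).
    by rewrite prodr_const addrC.
  rewrite bigA_distr; apply: eq_bigr => S _.
  by rewrite -big_mkcond prodr_const.
rewrite mulrC mulr_natr -sumr_const [leRHS](bigID (mem [set S : {set J} | (#|S| <= V)%N]))/=.
apply: ler_wpDr; first by apply: sumr_ge0 => S _; rewrite exprn_ge0// ltW.
by apply: ler_sum => S; rewrite inE => SV; rewrite ler_wiXn2l// ltW.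
Qed.

End sauer_shelah.

From mathcomp Require Import finmap.
From mathcomp Require Import all_classical all_reals all_analysis.
From mathcomp Require Import measurable_realfun.
From mathcomp Require Import ring lra.
Import numFieldNormedType.Exports.
Local Open Scope classical_set_scope.
Local Open Scope ring_scope.

(** * Patterns of a VC class on finitely many points *)

Section vc_patterns.
Context {U : Type} {J : finType}.
Variables (C : set (set U)) (V : nat) (pt : J -> U) (P : {set {set J}}).
Hypothesis CV : vc_index C V.
Hypothesis PC : forall A, A \in P ->
  exists2 c, C c & forall j, j \in A <-> c (pt j).

(** A shattered set with more than [V] indices contains one with exactly [V]. On it [pt] is
    injective, because shattering isolates each index, so its image would be a [V]-point set
    shattered by [C]. *)
Lemma shatters_card_le (S : {set J}) : shatters P S -> (#|S| <= V)%N.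
Proof.
move=> PS; rewrite leqNgt; apply/negP => VS.
have [S' S'S cS'] : exists2 S' : {set J}, S' \subset S & #|S'| = V.
  exists [set j in take V (enum S)]%SET.
    by apply/fintype.subsetP => j; rewrite finset.inE => /mem_take; rewrite mem_enum.
  rewrite finset.cardsE (card_uniqP (take_uniq V (enum_uniq (mem S)))).
  by rewrite size_takel// -cardE ltnW.
have {S'S}/shattersP PS' := shatters_sub S'S PS.
have injS' : {in S' &, injective pt}.
  move=> j k jS kS jk.
  have /PS'[A AP AS'] : [set j]%SET \subset S' by rewrite finset.sub1set.
  have [c _ cA] := PC AP.
  have : j \in [set j]%SET by rewrite finset.inE.
  rewrite -AS' finset.inE => /andP[/cA + _]; rewrite jk => /cA kA.
  have : k \in A :&: S' by rewrite finset.inE kA.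
  by rewrite AS' finset.inE => /eqP.
have [H _] := CV.
apply: (H (pt @` [set` S'])).
  apply: card_eq_trans (inj_card_eq _) _.
    by move=> j k; rewrite !inE; exact: injS'.
  have -> : [set` S'] = [set` [fset j in S']%fset].
    by apply/seteqP; split => j /=; rewrite !inE.
  by apply/card_eq_fsetP; rewrite card_imfset//= -cardE.
move=> B BS'.
pose B' := [set j in S' | `[< B (pt j) >]]%SET.
have /PS'[A AP AB] : B' \subset S'.
  by apply/fintype.subsetP => j; rewrite finset.inE => /andP[].
have [c Cc cA] := PC AP; exists c => //; apply/seteqP; split.
  move=> u [cu [j jS' ju]]; rewrite -ju in cu *.
  have : j \in A :&: S' by rewrite finset.inE jS' andbT; exact/cA.
  by rewrite AB finset.inE => /andP[_ /asboolP].
move=> u Bu; have [j jS' ju] := BS' _ Bu; split; last by exists j.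
rewrite -ju; apply/cA.
have : j \in B' by rewrite finset.inE; apply/andP; split => //; apply/asboolP; rewrite ju.
by rewrite -AB finset.inE => /andP[].
Qed.

(** Pajor's lemma reduces counting patterns to counting sets of size at most [V]. The parameter [x]
    stays free until [count_le_expR] tunes it. *)
Lemma card_patterns_le (R : realFieldType) (x : R) : 0 < x -> x <= 1 ->
  #|P|%:R * x ^+ V <= (1 + x) ^+ #|J|.
Proof.
move=> x0 x1; apply: le_trans (card_small_sets_le V x0 x1).
apply: ler_wpM2r; first by rewrite exprn_ge0// ltW.
rewrite ler_nat.
apply: (leq_trans (card_le_shattered P)); apply: subset_leq_card.
by apply/fintype.subsetP => S; rewrite !finset.inE; exact: shatters_card_le.
Qed.

End vc_patterns.

(** * Expectations under a density and under a product law *)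

Section expectation.
Context {R : realType}.
Local Notation mu := (@lebesgue_measure R).
Local Notation T := (measurableTypeR R).
Implicit Types (d : density R) (f g : T -> R).

Definition bounded_measurable f :=
  measurable_fun setT f /\ exists M : R, forall x, `|f x| <= M.

Definition expect d f : R := \int[mu]_x (f x * d x).

Lemma bounded_measurable_cst (r : R) : bounded_measurable (cst r).
Proof. by split => //; exists `|r|. Qed.

Lemma bounded_measurableD f g : bounded_measurable f -> bounded_measurable g ->
  bounded_measurable (fun x => f x + g x).
Proof.
move=> [mf [M fM]] [mg [N gN]]; split; first exact: measurable_funD.
by exists (M + N) => x; rewrite (le_trans (ler_normD _ _))// lerD.
Qed.

Lemma bounded_measurableM f g : bounded_measurable f -> bounded_measurable g ->
  bounded_measurable (fun x => f x * g x).
Proof.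
move=> [mf [M fM]] [mg [N gN]]; split; first exact: measurable_funM.
by exists (M * N) => x; rewrite normrM ler_pM.
Qed.

Lemma bounded_measurableZ (r : R) f : bounded_measurable f ->
  bounded_measurable (fun x => r * f x).
Proof. by move=> bf; apply: bounded_measurableM => //; exact: bounded_measurable_cst. Qed.

Lemma bounded_measurableB f g : bounded_measurable f -> bounded_measurable g ->
  bounded_measurable (fun x => f x - g x).
Proof.
move=> bf bg.
have -> : (fun x => f x - g x) = (fun x => f x + (-1) * g x).
  by apply/funext => x; rewrite mulN1r.
exact/bounded_measurableD/bounded_measurableZ.
Qed.

Lemma bounded_measurableX f k : bounded_measurable f ->
  bounded_measurable (fun x => f x ^+ k).
Proof.
move=> [mf [M fM]]; split; first exact: measurable_funX.
exists (M ^+ k) => x; rewrite normrX lerXn2r// ?nnegrE//.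
by rewrite (le_trans _ (fM x)).
Qed.

Lemma bounded_measurable_expR f : bounded_measurable f ->
  bounded_measurable (fun x => expR (f x)).
Proof.
move=> [mf [M fM]]; split; first exact: measurableT_comp.
exists (expR M) => x; rewrite ger0_norm ?expR_ge0// ler_expR.
by rewrite (le_trans (ler_norm _)).
Qed.

Lemma density_integrable d : mu.-integrable setT (EFin \o d).
Proof.
apply/integrableP; split; first by apply/measurable_EFinP; exact: measurable_pdf.
under eq_integral do rewrite /= ger0_norm ?pdf_ge0//.
by rewrite integral_pdf ltry.
Qed.

Lemma integrable_mul_pdf d f : bounded_measurable f ->
  mu.-integrable setT (EFin \o (fun x => f x * d x)).
Proof.
move=> [mf [M fM]].
apply: (@le_integrable _ _ _ _ _ measurableT _ (EFin \o (fun x => M * d x))).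
- by apply/measurable_EFinP; apply: measurable_funM => //; exact: measurable_pdf.
- move=> x _ /=; rewrite lee_fin normrM normrM ler_pM//.
  by rewrite (le_trans (fM x))// ler_norm.
- have -> : EFin \o (fun x => M * d x) = (fun x => M%:E * (EFin \o d) x)%E by [].
  by apply: integrableZl => //; exact: density_integrable.
Qed.

Lemma eq_expect d f g : f =1 g -> expect d f = expect d g.
Proof. by move=> fg; apply: eq_Rintegral => x _; rewrite fg. Qed.

Lemma expect_cst d (r : R) : expect d (fun=> r) = r.
Proof.
rewrite /expect RintegralZl//; last exact: density_integrable.
by rewrite /Rintegral integral_pdf mulr1.
Qed.

Lemma expectZ d (r : R) f : bounded_measurable f ->
  expect d (fun x => r * f x) = r * expect d f.
Proof.
move=> bf; rewrite /expect -RintegralZl//; last exact: integrable_mul_pdf.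
by apply: eq_Rintegral => x _; rewrite mulrA.
Qed.

Lemma expectD d f g : bounded_measurable f -> bounded_measurable g ->
  expect d (fun x => f x + g x) = expect d f + expect d g.
Proof.
move=> bf bg; rewrite /expect -RintegralD//; [|exact: integrable_mul_pdf..].
by apply: eq_Rintegral => x _; rewrite mulrDl.
Qed.

Lemma expectB d f g : bounded_measurable f -> bounded_measurable g ->
  expect d (fun x => f x - g x) = expect d f - expect d g.
Proof.
move=> bf bg; rewrite /expect -RintegralB//; [|exact: integrable_mul_pdf..].
by apply: eq_Rintegral => x _; rewrite mulrBl.
Qed.

Lemma le_expect d f g : bounded_measurable f -> bounded_measurable g ->
  (forall x, f x <= g x) -> expect d f <= expect d g.
Proof.
move=> bf bg fg; apply: le_Rintegral => //; [exact: integrable_mul_pdf..|].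
by move=> x _; rewrite ler_wpM2r// pdf_ge0.
Qed.

Lemma expect_ge0 d f : (forall x, 0 <= f x) -> 0 <= expect d f.
Proof. by move=> f0; apply: Rintegral_ge0 => x _; rewrite mulr_ge0// pdf_ge0. Qed.

Lemma le_norm_expect d f (M : R) : bounded_measurable f ->
  (forall x, `|f x| <= M) -> `|expect d f| <= M.
Proof.
move=> bf fM; rewrite ler_norml -[M in - M](expect_cst d) -[M in _ && (_ <= M)](expect_cst d).
have E : - expect d (fun=> M) = expect d (fun=> - M).
  by rewrite !expect_cst.
rewrite E; apply/andP; split; apply: le_expect => //; try exact: bounded_measurable_cst.
  by move=> x; have := fM x; rewrite ler_norml => /andP[].
by move=> x; have := fM x; rewrite ler_norml => /andP[].
Qed.

Lemma density_prob_dominated d : density_prob d `<< mu.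
Proof.
apply/null_content_dominatesP => A mA muA0; apply: null_set_integral => //.
by apply/measurable_funTS/measurable_EFinP; exact: measurable_pdf.
Qed.

Lemma integrable_density_prob d f : bounded_measurable f ->
  (density_prob d).-integrable setT (EFin \o f).
Proof.
move=> [mf [M fM]]; apply: measurable_bounded_integrable => //.
  by apply: (@le_lt_trans _ _ 1%E); [rewrite -(integral_pdf d)|exact: ltry].
exists M; split; first exact: num_real.
by move=> N MN x _; exact: le_trans (fM x) (ltW MN).
Qed.

(** Change of variables through the Radon-Nikodym derivative of [density_prob d], which agrees
    almost everywhere with [d] as both have the same integrals over measurable sets. *)
Lemma integral_density_prob d f : bounded_measurable f ->
  (\int[density_prob d]_x (f x)%:E)%E = (expect d f)%:E.
Proof.
move=> bf; rewrite /expect /Rintegral fineK; last first.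
  by apply: (integrable_fin_num measurableT); exact: integrable_mul_pdf.
have mf : measurable_fun setT (EFin \o f) by case: bf => mf _; exact/measurable_EFinP.
rewrite -(Radon_Nikodym_change_of_variables (density_prob_dominated d))//; last first.
  exact: integrable_density_prob.
under [RHS]eq_integral do rewrite EFinM.
apply: ae_eq_integral => //.
- apply: emeasurable_funM => //; apply: (measurable_int mu).
  apply: Radon_Nikodym_integrable; exact: density_prob_dominated.
- by apply: emeasurable_funM => //; apply/measurable_EFinP; exact: measurable_pdf.
- apply: ae_eqe_mul2l; rewrite Radon_NikodymE.
    exact: density_prob_dominated.
  move=> dmu; case: cid => h /= [_ hi hE].
  apply: integral_ae_eq => //; last by move=> E _ mE; rewrite -hE.
  by apply/measurable_EFinP; exact: measurable_pdf.
Qed.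

End expectation.

Section law_integral.
Context {R : realType}.
Local Notation T := (measurableTypeR R).

Lemma ge0_integral_law_cons n (t : L0 R n.+1) (F : n.+1.-tuple T -> \bar R) :
  measurable_fun setT F -> (forall x, 0 <= F x)%E ->
  (\int[law t]_x F x =
   \int[density_prob (t ord0)]_y
     \int[law (fun i : 'I_n => t (lift ord0 i))]_x F (cons_sample (y, x)))%E.
Proof.
move=> mF F0.
rewrite [LHS]ge0_integral_distribution//.
rewrite (@fubini_tonelli1 _ _ _ _ _ _ _ (F \o @cons_sample R n))//.
  by apply: measurableT_comp => //; exact: measurable_cons.
by move=> z; exact: F0.
Qed.

Lemma measurable_prod_coord n (f : 'I_n -> T -> R) :
  (forall i, measurable_fun setT (f i)) ->
  measurable_fun setT (fun X : n.-tuple T => \prod_(i < n) f i (tnth X i)).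
Proof.
move=> mf; apply: measurable_prod => i _.
by apply: measurableT_comp => //; exact: measurable_tnth.
Qed.

Lemma integral_law_prod n (t : L0 R n) (f : 'I_n -> T -> R) :
  (forall i, bounded_measurable (f i)) -> (forall i x, 0 <= f i x) ->
  (\int[law t]_X (\prod_(i < n) f i (tnth X i))%:E =
   (\prod_(i < n) expect (t i) (f i))%:E)%E.
Proof.
elim: n t f => [|n IHn] t f bf f0.
  rewrite big_ord0; under eq_integral do rewrite big_ord0.
  by rewrite integral_cst//= probability_setT mul1e.
rewrite ge0_integral_law_cons; last 2 first.
- apply/measurable_EFinP; apply: (@measurable_prod_coord n.+1 f) => i.
  by case: (bf i).
- by move=> X; rewrite lee_fin prodr_ge0.
under eq_integral => y _.
  under eq_integral => x _.
    rewrite big_ord_recl EFinM.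
    have -> : tnth (cons_sample (y, x)) ord0 = y by [].
    under eq_bigr do rewrite tnthS.
    over.
  rewrite ge0_integralZl ?lee_fin//; last 2 first.
  - apply/measurable_EFinP; apply: (@measurable_prod_coord n (fun i => f (lift ord0 i))) => i.
    by case: (bf (lift ord0 i)).
  - by move=> X; rewrite lee_fin prodr_ge0.
  rewrite (IHn _ (fun i => f (lift ord0 i)))// muleC.
  over.
rewrite ge0_integralZl//; last 3 first.
- by apply/measurable_EFinP; case: (bf ord0).
- by move=> y _; rewrite lee_fin.
- by rewrite lee_fin prodr_ge0// => i _; exact: expect_ge0.
by rewrite integral_density_prob// big_ord_recl muleC EFinM.
Qed.

Lemma integral_law_coord n (t : L0 R n) i (f : T -> R) :
  bounded_measurable f ->
  (\int[law t]_X (f (tnth X i))%:E = (expect (t i) f)%:E)%E.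
Proof.
move=> bf; have [mf [M fM]] := bf.
have mfi : measurable_fun setT (fun X : n.-tuple T => f (tnth X i)).
  by apply: measurableT_comp => //; exact: measurable_tnth.
(* The product formula needs nonnegative factors: [f] is shifted by its bound [M], the other factors
   are [1], and [M] is subtracted at the end. *)
pose g j x : R := if j == i then f x + M else 1.
have bg j : bounded_measurable (g j).
  rewrite /g; case: eqP => _; last exact: bounded_measurable_cst.
  by apply: bounded_measurableD => //; exact: bounded_measurable_cst.
have g0 j x : 0 <= g j x.
  by rewrite /g; case: eqP => // _; have := fM x; rewrite ler_norml; lra.
have ifi : (law t).-integrable setT (EFin \o (fun X => f (tnth X i))).
  apply: measurable_bounded_integrable => //.
    by apply: (@le_lt_trans _ _ 1%E); [rewrite -(probability_setT (law t))|exact: ltry].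
  exists M; split; first exact: num_real.
  by move=> N MN x _; exact: le_trans (fM _) (ltW MN).
have icst : (law t).-integrable setT (EFin \o cst M).
  apply: measurable_bounded_integrable => //.
    by apply: (@le_lt_trans _ _ 1%E); [rewrite -(probability_setT (law t))|exact: ltry].
  exists `|M|; split; first exact: num_real.
  by move=> N MN x _; exact: ltW.
have := @integral_law_prod n t g bg g0.
rewrite (bigD1 i)//= big1; last first.
  move=> j ji; rewrite -[RHS](expect_cst (t j)); apply: eq_expect => x.
  by rewrite /g (negbTE ji).
rewrite mulr1; under eq_integral => X _.
  rewrite (bigD1 i)//= big1; last first.
    by move=> j ji; rewrite /g (negbTE ji).
  rewrite /g eqxx mulr1 EFinD.
  over.
rewrite integralD// integral_cst// /= probability_setT mule1.
have -> : expect (t i) (g i) = expect (t i) f + M.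
  rewrite -[M in RHS](expect_cst (t i)) -expectD//; last exact: bounded_measurable_cst.
  by apply: eq_expect => x; rewrite /g eqxx.
by rewrite EFinD => /(congr1 (fun z => z - M%:E)%E); rewrite !addeK.
Qed.

End law_integral.

(** * The score and the Hellinger distance *)

Section psi_ratio.
Context {R : realType}.
Local Notation T := (measurableTypeR R).
Implicit Types a b : R.

(* The value at [a = b = 0] is [0 = psi 1], in accordance with [0 / 0 = 1]. *)
Definition psi_ratio a b : R := (Num.sqrt a - Num.sqrt b) / Num.sqrt (a + b).

(** The symmetric form absorbs the conventions on quotients: for [b = 0] both sides are [1] if
    [a > 0] and [0] if [a = 0]. *)
Lemma psi_sqrte_ratio a b : 0 <= a -> 0 <= b ->
  psi (sqrte (Defs.ratio a b)) = psi_ratio a b.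
Proof.
move=> a0 b0; rewrite /Defs.ratio /psi_ratio.
have [->|bn0] := eqVneq b 0.
  have [->|an0] := eqVneq a 0.
    by rewrite /= sqrtr1 sqrtr0 !subrr !mul0r.
  rewrite /= addr0 sqrtr0 subr0 divff// sqrtr_eq0 -ltNge.
  by rewrite lt_neqAle eq_sym an0.
have bp : 0 < b by rewrite lt_neqAle eq_sym bn0.
have sb : 0 < Num.sqrt b by rewrite sqrtr_gt0.
rewrite /= sqr_sqrtr ?divr_ge0// sqrtrM// sqrtrV//.
have -> : 1 + a / b = (a + b) / b by field; rewrite gt_eqF.
rewrite sqrtrM ?addr_ge0// sqrtrV//.
have sab : 0 < Num.sqrt (a + b) by rewrite sqrtr_gt0 ltr_wpDl.
by field; rewrite !gt_eqF.
Qed.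

Lemma psi_ratioC a b : psi_ratio b a = - psi_ratio a b.
Proof. by rewrite /psi_ratio (addrC b) -mulNr opprB. Qed.

Lemma sqr_psi_ratioD a b : 0 <= a -> 0 <= b ->
  psi_ratio a b ^+ 2 * (a + b) = (Num.sqrt a - Num.sqrt b) ^+ 2.
Proof.
move=> a0 b0; rewrite /psi_ratio exprMn exprVn sqr_sqrtr ?addr_ge0//.
have [ab0|abn0] := eqVneq (a + b) 0; last by rewrite divfK.
have [-> ->] : a = 0 /\ b = 0 by lra.
by rewrite sqrtr0 subrr expr0n !mul0r.
Qed.

Lemma normr_psi_ratio_le1 a b : 0 <= a -> 0 <= b -> `|psi_ratio a b| <= 1.
Proof.
move=> a0 b0.
have [ab0|abn0] := eqVneq (a + b) 0.
  have [-> ->] : a = 0 /\ b = 0 by lra.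
  by rewrite /psi_ratio sqrtr0 subrr mul0r normr0.
have abp : 0 < a + b by lra.
rewrite -(@ler_pXn2r _ 2)// ?nnegrE// expr1n real_normK ?num_real//.
rewrite -(ler_pM2r abp) mul1r sqr_psi_ratioD// sqrrB !sqr_sqrtr//.
have : 0 <= Num.sqrt a * Num.sqrt b by rewrite mulr_ge0.
lra.
Qed.

(** After cross-multiplication the terms compare separately: [a * (a' + b) <= a' * (a + b)] and
    [a + b <= a' + b]. This transfers the monotonicity of [q] on each side of its mode to the
    scores. *)
Lemma psi_ratio_nondecreasing a a' b : 0 <= a -> 0 <= b -> a <= a' ->
  psi_ratio a b <= psi_ratio a' b.
Proof.
move=> a0 b0 aa'; rewrite /psi_ratio.
have a'0 : 0 <= a' by exact: le_trans aa'.
have [ab0|abn0] := eqVneq (a + b) 0.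
  have [-> ->] : a = 0 /\ b = 0 by lra.
  by rewrite sqrtr0 !subr0 mul0r divr_ge0.
have abp : 0 < a + b by lra.
rewrite ler_pdivrMr ?sqrtr_gt0// mulrAC ler_pdivlMr ?sqrtr_gt0//; last by lra.
have H1 : Num.sqrt a * Num.sqrt (a' + b) <= Num.sqrt a' * Num.sqrt (a + b).
  by rewrite -!sqrtrM// ler_sqrt ?mulr_ge0//; nra.
have H2 : Num.sqrt b * Num.sqrt (a + b) <= Num.sqrt b * Num.sqrt (a' + b).
  by rewrite ler_wpM2l// ler_sqrt; lra.
by rewrite !mulrBl; lra.
Qed.

Lemma measurable_sqrtr (f : T -> R) : measurable_fun setT f ->
  measurable_fun setT (fun x => Num.sqrt (f x)).
Proof.
move=> mf; apply: (measurableT_comp _ mf).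
by apply: continuous_measurable_fun; exact: sqrt_continuous.
Qed.

Lemma measurable_sqrtrV (f : T -> R) : (forall x, 0 <= f x) ->
  measurable_fun setT f -> measurable_fun setT (fun x => (Num.sqrt (f x))^-1).
Proof.
move=> f0 mf.
have -> : (fun x => (Num.sqrt (f x))^-1) = (@powR R ^~ (- 2^-1)) \o f.
  by apply/funext => x /=; rewrite powRN powR12_sqrt.
by apply: measurableT_comp => //; exact: measurable_powR.
Qed.

Lemma measurable_psi_ratio (f g : T -> R) : (forall x, 0 <= f x) ->
  (forall x, 0 <= g x) -> measurable_fun setT f -> measurable_fun setT g ->
  measurable_fun setT (fun x => psi_ratio (f x) (g x)).
Proof.
move=> f0 g0 mf mg; apply: measurable_funM.
  by apply: measurable_funB; exact: measurable_sqrtr.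
apply: measurable_sqrtrV; first by move=> x; rewrite addr_ge0.
exact: measurable_funD.
Qed.

Lemma bounded_measurable_psi_ratio (u v : density R) :
  bounded_measurable (fun x => psi_ratio (u x) (v x)).
Proof.
split; first by apply: measurable_psi_ratio; (exact: pdf_ge0 || exact: measurable_pdf).
by exists 1 => x; apply: normr_psi_ratio_le1; exact: pdf_ge0.
Qed.

End psi_ratio.

Section hellinger.
Context {R : realType}.
Local Notation mu := (@lebesgue_measure R).
Local Notation T := (measurableTypeR R).
Implicit Types (s u v w : density R).

Lemma integrable_le_pdf u v w (g : T -> R) (M : R) : measurable_fun setT g ->
  (forall x, `|g x| <= M * (u x + v x + w x)) ->
  mu.-integrable setT (EFin \o g).
Proof.
move=> mg gM.
apply: (@le_integrable _ _ _ _ _ measurableT _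
  (EFin \o (fun x => M * (u x + v x + w x)))).
- exact/measurable_EFinP.
- by move=> x _ /=; rewrite lee_fin (le_trans (gM x))// ler_norm.
- have -> : EFin \o (fun x => M * (u x + v x + w x)) = (fun x =>
      M%:E * (((EFin \o u) x + (EFin \o v) x) + (EFin \o w) x))%E by [].
  apply: integrableZl => //.
  apply: integrableD => //; last exact: density_integrable.
  by apply: integrableD => //; exact: density_integrable.
Qed.

Lemma integrable_EFinD (f g : T -> R) : mu.-integrable setT (EFin \o f) ->
  mu.-integrable setT (EFin \o g) ->
  mu.-integrable setT (EFin \o (fun x => f x + g x)).
Proof. by move=> If Ig; exact: (integrableD _ If Ig). Qed.

Lemma integrable_EFinZ (M : R) (f : T -> R) : mu.-integrable setT (EFin \o f) ->
  mu.-integrable setT (EFin \o (fun x => M * f x)).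
Proof. by move=> If; exact: (integrableZl _ _ If). Qed.

Lemma Rintegral_pdf u : \int[mu]_x u x = 1.
Proof. by rewrite /Rintegral integral_pdf. Qed.

Lemma sqr_sqrtrB_le (a b : R) : 0 <= a -> 0 <= b ->
  (Num.sqrt a - Num.sqrt b) ^+ 2 <= a + b.
Proof.
move=> a0 b0; rewrite sqrrB !sqr_sqrtr//.
have : 0 <= Num.sqrt a * Num.sqrt b by rewrite mulr_ge0.
lra.
Qed.

Lemma integrable_h2 u v : mu.-integrable setT
  (EFin \o (fun x => (Num.sqrt (u x) - Num.sqrt (v x)) ^+ 2)).
Proof.
apply: (@integrable_le_pdf u v v _ 1).
  by apply: measurable_funX; apply: measurable_funB; apply: measurable_sqrtr;
    exact: measurable_pdf.
move=> x; rewrite ger0_norm ?sqr_ge0// mul1r.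
rewrite (le_trans (sqr_sqrtrB_le (pdf_ge0 u x) (pdf_ge0 v x)))//.
by rewrite lerDl pdf_ge0.
Qed.

Lemma h2_ge0 u v : 0 <= h2 u v.
Proof. by rewrite mulr_ge0// Rintegral_ge0// => x _; rewrite sqr_ge0. Qed.

Lemma h2C u v : h2 u v = h2 v u.
Proof. by congr (_ * _); apply: eq_Rintegral => x _; rewrite -sqrrN opprB. Qed.

Lemma h2_triangle u v w : h2 u w <= 2 * h2 u v + 2 * h2 v w.
Proof.
rewrite /h2 !mulrA divff// !mul1r mulrC ler_pdivrMr// mulrC mulrDr.
rewrite -!RintegralZl//; [|exact: integrable_h2..].
rewrite -RintegralD//; [|exact/integrable_EFinZ/integrable_h2..].
apply: le_Rintegral => //; first exact: integrable_h2.
  by apply: integrable_EFinD; exact/integrable_EFinZ/integrable_h2.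
move=> x _; set a := Num.sqrt _; set b := Num.sqrt (w x); set c := Num.sqrt _.
by have := sqr_ge0 (a + b - 2 * c); rewrite !expr2; lra.
Qed.

Variables (s v v' : density R).
Let r x := (v x + v' x) / 2.
Let sigma x := Num.sqrt (s x).
Let a x := Num.sqrt (v' x).
Let c x := Num.sqrt (v x).
Let w := (Num.sqrt 2)^-1 : R.

Lemma sqrt2V_sqr : w ^+ 2 = 2^-1.
Proof. by rewrite exprVn sqr_sqrtr. Qed.

Lemma sqrt2V_gt0 : 0 < w.
Proof. by rewrite invr_gt0 sqrtr_gt0. Qed.

Lemma sqrt2V_lt : w < 71 / 100.
Proof.
by have := sqrt2V_sqr; have := sqrt2V_gt0; rewrite expr2; nra.
Qed.

(* With [e = sqrt r], [sqrt (v r) + sqrt (v / r) s] exceeds [2 sqrt (s v)] by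
   [sqrt (v / r) (e - sigma)^2], which lies between [0] and
   [sqrt 2 (e - sigma)^2]. *)
Lemma test_pointwise x :
  2^-1 * (Num.sqrt (v' x * r x) - Num.sqrt (v x * r x))
    + w * (psi_ratio (v' x) (v x) * s x) <=
  (1 + w) / 2 * (sigma x - c x) ^+ 2 - (1 - w) / 2 * (sigma x - a x) ^+ 2
    + (v' x - v x) / 2.
Proof.
have v0 : 0 <= v x by exact: pdf_ge0.
have v'0 : 0 <= v' x by exact: pdf_ge0.
have s0 : 0 <= s x by exact: pdf_ge0.
have c0 : 0 <= c x by exact: sqrtr_ge0.
have a0 : 0 <= a x by exact: sqrtr_ge0.
have g0 : 0 <= sigma x by exact: sqrtr_ge0.
have r0 : 0 <= r x by rewrite divr_ge0// addr_ge0.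
pose e := Num.sqrt (r x).
have e0 : 0 <= e by exact: sqrtr_ge0.
have vE : v x = c x ^+ 2 by rewrite sqr_sqrtr.
have v'E : v' x = a x ^+ 2 by rewrite sqr_sqrtr.
have sE : s x = sigma x ^+ 2 by rewrite sqr_sqrtr.
have eE : e ^+ 2 = (c x ^+ 2 + a x ^+ 2) / 2 by rewrite sqr_sqrtr// -vE -v'E.
have w0 := sqrt2V_gt0.
have w2 := sqrt2V_sqr.
rewrite (sqrtrM _ v0) (sqrtrM _ v'0) -/(a x) -/(c x) -/e.
have -> : w * (psi_ratio (v' x) (v x) * s x) = 2^-1 * ((a x - c x) / e) * sigma x ^+ 2.
  rewrite /psi_ratio -/(a x) -/(c x) sE -w2.
  have -> : v' x + v x = 2 * r x by rewrite /r; lra.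
  rewrite sqrtrM// invfM -/w -/e; ring.
have [ez|en0] := eqVneq e 0.
  have [-> ->] : c x = 0 /\ a x = 0.
    by move: eE; rewrite ez; split; nra.
  by rewrite vE v'E ez invr0 !(mulr0, mul0r, subr0, subrr); nra.
have ep : 0 < e by rewrite lt_neqAle eq_sym en0.
rewrite vE v'E.
(* Scaling by [e] gives [A ^+ 2 + C ^+ 2 = 2], whence [A <= sqrt 2 = 2 * w] and [A + C <= 2]. In the
   decomposition below, these make the first two terms nonnegative and the third zero. *)
pose A := a x / e; pose C := c x / e.
have A0 : 0 <= A by rewrite divr_ge0.
have C0 : 0 <= C by rewrite divr_ge0.
have aE : a x = A * e by rewrite divfK.
have cE : c x = C * e by rewrite divfK.
have AC : A ^+ 2 + C ^+ 2 = 2.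
  apply: (mulIf (expf_neq0 2 en0)).
  by rewrite mulrDl -!exprMn -aE -cE eE; lra.
have A2w : A <= 2 * w.
  by rewrite leNgt; apply/negP => wA; clearbody A C; move: w2; rewrite !expr2; nra.
have AC2 : A + C <= 2.
  by have := sqr_ge0 (A - 1); have := sqr_ge0 (C - 1); clearbody A C; lra.
have acE : (a x - c x) / e = A - C by rewrite mulrBl.
rewrite acE aE cE; clearbody A C; rewrite -subr_ge0.
rewrite [leRHS](_ : _ =
  (w - (A - C) / 2) * (e - sigma x) ^+ 2 + w * (2 - (A + C)) * (sigma x * e)
   + w / 2 * (A ^+ 2 + C ^+ 2 - 2) * e ^+ 2); last by field.
rewrite AC subrr mulr0 mul0r addr0 addr_ge0//.
  by rewrite mulr_ge0 ?sqr_ge0//; lra.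
by rewrite !mulr_ge0//; lra.
Qed.

(** With [e ^+ 2] the mean of [v] and [v'], split [sigma^2 <= 2 (sigma - e)^2 + 2 e^2]. The score is
    at most [1] in absolute value, which handles the first part; its square times [2 e^2] is exactly
    [(a - c)^2], which handles the second. *)
Lemma sqr_psi_ratio_pointwise x : psi_ratio (v' x) (v x) ^+ 2 * s x <=
  3 * (sigma x - c x) ^+ 2 + 3 * (sigma x - a x) ^+ 2.
Proof.
have v0 : 0 <= v x by exact: pdf_ge0.
have v'0 : 0 <= v' x by exact: pdf_ge0.
have s0 : 0 <= s x by exact: pdf_ge0.
have vE : v x = c x ^+ 2 by rewrite sqr_sqrtr.
have v'E : v' x = a x ^+ 2 by rewrite sqr_sqrtr.
have sE : s x = sigma x ^+ 2 by rewrite sqr_sqrtr.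
have r0 : 0 <= r x by rewrite divr_ge0// addr_ge0.
pose e := Num.sqrt (r x).
have e0 : 0 <= e by exact: sqrtr_ge0.
have eE : e ^+ 2 = (c x ^+ 2 + a x ^+ 2) / 2 by rewrite sqr_sqrtr// -vE -v'E.
have p1 := normr_psi_ratio_le1 v'0 v0.
have p2 := sqr_psi_ratioD v'0 v0.
move: p1 p2; set p := psi_ratio _ _; rewrite -/(a x) -/(c x) => p1 p2.
have pp : p ^+ 2 <= 1.
  by rewrite -(@ler_pXn2r _ 2)// ?nnegrE// expr1n real_normK ?num_real in p1.
have ac : (c x + a x) / 2 <= e.
  rewrite -(@ler_pXn2r _ 2)// ?nnegrE ?divr_ge0 ?addr_ge0 ?sqrtr_ge0// eE.
  by have := sqr_ge0 (c x - a x); nra.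
have g0 : 0 <= sigma x by exact: sqrtr_ge0.
have H1 : sigma x ^+ 2 <= 2 * (sigma x - e) ^+ 2 + 2 * e ^+ 2.
  by have := sqr_ge0 (sigma x - 2 * e); nra.
have H2 : (sigma x - e) ^+ 2 <= ((sigma x - c x) ^+ 2 + (sigma x - a x) ^+ 2) / 2.
  by nra.
have H3 : p ^+ 2 * e ^+ 2 *+ 2 = (a x - c x) ^+ 2 by rewrite -p2 eE vE v'E; lra.
have H4 : p ^+ 2 * sigma x ^+ 2 <= 2 * (sigma x - e) ^+ 2 + (a x - c x) ^+ 2.
  have := ler_wpM2l (sqr_ge0 p) H1; have := ler_wpM2r (sqr_ge0 (sigma x - e)) pp.
  by lra.
by rewrite sE; have := sqr_ge0 (sigma x *+ 2 - c x - a x); nra.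
Qed.

(** Integrating [test_pointwise] removes the term [(v' - v) / 2], as both densities have mass one.
    The left side is the mean of one coordinate of [stat_T] under [s]. *)
Lemma expect_test_le :
  2^-1 * (affinity v' r - affinity v r)
    + w * expect s (fun x => psi_ratio (v' x) (v x)) <=
  (1 + w) * h2 s v - (1 - w) * h2 s v'.
Proof.
have Iv := density_integrable v; have Iv' := density_integrable v'.
have Ir (u : density R) : (forall x, u x <= v x + v' x) ->
    mu.-integrable setT (EFin \o (fun x => Num.sqrt (u x * r x))).
  move=> uv; apply: (@integrable_le_pdf v v' v _ 1).
    apply: measurable_sqrtr; apply: measurable_funM; first exact: measurable_pdf.
    apply: measurable_funM => //.
    by apply: measurable_funD; exact: measurable_pdf.
  move=> x; rewrite ger0_norm ?sqrtr_ge0// mul1r.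
  have := pdf_ge0 v x; have := pdf_ge0 v' x; have := pdf_ge0 u x; have := uv x.
  move=> h1 h2 h3 h4.
  rewrite -[leRHS]ger0_norm; last by lra.
  by rewrite -sqrtr_sqr ler_sqrt ?sqr_ge0// /r; nra.
have Ir1 : mu.-integrable setT (EFin \o (fun x => Num.sqrt (v' x * r x))).
  by apply: Ir => x; rewrite lerDr pdf_ge0.
have Ir2 : mu.-integrable setT (EFin \o (fun x => Num.sqrt (v x * r x))).
  by apply: Ir => x; rewrite lerDl pdf_ge0.
have Ip := integrable_mul_pdf s (bounded_measurable_psi_ratio v' v).
have IB (f g : T -> R) : mu.-integrable setT (EFin \o f) ->
  mu.-integrable setT (EFin \o g) ->
  mu.-integrable setT (EFin \o (fun x => f x - g x)).
  by move=> If Ig; exact: (integrableB _ If Ig).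
have I1 := IB _ _ Ir1 Ir2.
have I2 := integrable_h2 s v; have I3 := integrable_h2 s v'.
have I4 := IB _ _ Iv' Iv.
have Z1 := integrable_EFinZ 2^-1 I1; have Z2 := integrable_EFinZ w Ip.
rewrite /affinity -RintegralB// /expect -(RintegralZl 2^-1 measurableT I1) -(RintegralZl w measurableT Ip) -RintegralD//.
apply: (@le_trans _ _ (\int[mu]_x ((1 + w) / 2 * (sigma x - c x) ^+ 2
    - (1 - w) / 2 * (sigma x - a x) ^+ 2 + 2^-1 * (v' x - v x)))).
  apply: le_Rintegral => //.
  - exact: integrable_EFinD.
  - exact: (integrable_EFinD (IB _ _ (integrable_EFinZ _ I2)
      (integrable_EFinZ _ I3)) (integrable_EFinZ _ I4)).
  - by move=> x _; rewrite (le_trans (test_pointwise x))// lerD2l mulrC.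
have Z3 := integrable_EFinZ ((1 + w) / 2) I2.
have Z4 := integrable_EFinZ ((1 - w) / 2) I3.
rewrite (RintegralD measurableT (IB _ _ Z3 Z4) (integrable_EFinZ 2^-1 I4)).
rewrite (RintegralB measurableT Z3 Z4).
rewrite !(RintegralZl _ measurableT I2, RintegralZl _ measurableT I3,
  RintegralZl _ measurableT I4) RintegralB// !Rintegral_pdf subrr mulr0 addr0.
by rewrite /h2 !mulrA.
Qed.

Lemma expect_sqr_psi_ratio_le :
  expect s (fun x => psi_ratio (v' x) (v x) ^+ 2) <= 6 * h2 s v + 6 * h2 s v'.
Proof.
rewrite /h2 !mulrA (_ : 6 / 2 = 3); last by lra.
rewrite -!RintegralZl//; [|exact: integrable_h2..].
rewrite -RintegralD//; [|exact/integrable_EFinZ/integrable_h2..].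
apply: le_Rintegral => //.
- exact/integrable_mul_pdf/bounded_measurableX/bounded_measurable_psi_ratio.
- by apply: integrable_EFinD; exact/integrable_EFinZ/integrable_h2.
- by move=> x _; exact: sqr_psi_ratio_pointwise.
Qed.

End hellinger.

(** * Exponential moments *)

Section bernstein.
Context {R : realType}.
Local Notation T := (measurableTypeR R).

(** Compare [expR u * (1 - u) <= 1] with [(1 + u + 2 u^2) (1 - u) = 1 + u^2 (1 - 2 u) >= 1]. *)
Lemma expR_le_quadratic (u : R) : u <= 2^-1 -> expR u <= 1 + u + 2 * u ^+ 2.
Proof.
move=> u2; have u1 : 0 < 1 - u by lra.
have H : expR u * (1 - u) <= 1.
  have := expR_ge1Dx (- u); have := expRxMexpNx_1 u; have := expR_gt0 u.
  by move=> e0 <- e1; rewrite ler_pM2l.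
rewrite -(ler_pM2r u1) (le_trans H)//.
have : 0 <= u ^+ 2 * (1 - 2 * u) by rewrite mulr_ge0 ?sqr_ge0//; lra.
by rewrite !expr2; lra.
Qed.

(** Bernstein's argument: [lambda * (f - E f)] is at most [2 * lambda * M <= 1/2], so the quadratic
    bound applies. The compensator is the second moment, which [expect_sqr_psi_ratio_le]
    controls. *)
Lemma expect_expR_le (d : density R) (f : T -> R) (M lambda : R) :
  bounded_measurable f -> (forall x, `|f x| <= M) -> 0 < lambda ->
  lambda * (4 * M) <= 1 ->
  expect d (fun x => expR (lambda * (f x - expect d f)
                           - 2 * lambda ^+ 2 * expect d (fun x => f x ^+ 2))) <= 1.
Proof.
move=> bf fM l0 lM; set e := expect d f; set e2 := expect d (fun x => f x ^+ 2).
have be : bounded_measurable (fun x => f x - e).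
  by apply: bounded_measurableB => //; exact: bounded_measurable_cst.
have eM : `|e| <= M by exact: le_norm_expect.
have b2 := bounded_measurableX 2 bf.
have bl := bounded_measurableZ lambda be.
have bl2 := bounded_measurableZ 2 (bounded_measurableX 2 bl).
have bc (c : R) : @bounded_measurable R (fun=> c) := bounded_measurable_cst c.
have H : expect d (fun x => expR (lambda * (f x - e))) <=
    1 + 2 * lambda ^+ 2 * e2.
  apply: (@le_trans _ _ (expect d (fun x => 1 + lambda * (f x - e) +
      2 * (lambda * (f x - e)) ^+ 2))).
    apply: le_expect.
    - exact: bounded_measurable_expR.
    - exact: (bounded_measurableD (bounded_measurableD (bc 1) bl) bl2).
    - move=> x; apply: expR_le_quadratic.
      have : f x - e <= 2 * M.
        by have := fM x; move: eM; rewrite !ler_norml; lra.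
      by nra.
  rewrite (expectD _ (bounded_measurableD (bc 1) bl) bl2).
  rewrite (expectD _ (bc 1) bl) expect_cst expectZ// expectB// expect_cst subrr mulr0 addr0.
  have -> : expect d (fun x => 2 * (lambda * (f x - e)) ^+ 2) =
      2 * lambda ^+ 2 * (e2 - e ^+ 2).
    have E x : 2 * (lambda * (f x - e)) ^+ 2 =
        2 * lambda ^+ 2 * (f x ^+ 2 - (2 * e * f x - e ^+ 2)) by ring.
    rewrite (eq_expect _ E) expectZ; last first.
      apply: bounded_measurableB => //; apply: bounded_measurableB => //.
      exact: bounded_measurableZ.
    rewrite expectB//; last first.
      by apply: bounded_measurableB => //; exact: bounded_measurableZ.
    rewrite expectB//; last exact: bounded_measurableZ.
    by rewrite expectZ// expect_cst -/e2 -/e; congr (_ * _); ring.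
  have := sqr_ge0 e; have := sqr_ge0 lambda; nra.
rewrite (eq_expect _ (fun x => expRD _ _)).
rewrite (eq_expect _ (fun x => mulrC _ _)) expectZ; last exact: bounded_measurable_expR.
rewrite expRN mulrC ler_pdivrMr ?expR_gt0// mul1r.
exact: le_trans H (expR_ge1Dx _).
Qed.

Lemma integral_law_expR_le1 n (t : L0 R n) (f : 'I_n -> T -> R) (M lambda : R) :
  (forall i, bounded_measurable (f i)) -> (forall i x, `|f i x| <= M) ->
  0 < lambda -> lambda * (4 * M) <= 1 ->
  (\int[law t]_X (expR (\sum_(i < n) (lambda * (f i (tnth X i) - expect (t i) (f i))
       - 2 * lambda ^+ 2 * expect (t i) (fun x => f i x ^+ 2))))%:E <= 1)%E.
Proof.
move=> bf fM l0 lM.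
under eq_integral do rewrite expR_sum.
rewrite (integral_law_prod t (f := fun i x => expR (lambda * (f i x - expect (t i) (f i))
       - 2 * lambda ^+ 2 * expect (t i) (fun x => f i x ^+ 2)))); last 2 first.
- move=> i; apply: bounded_measurable_expR; apply: bounded_measurableB; last exact: bounded_measurable_cst.
  apply: bounded_measurableZ; apply: bounded_measurableB => //; exact: bounded_measurable_cst.
- by move=> i x; exact: expR_ge0.
rewrite lee_fin; apply: prodr_ile1 => i _; apply/andP; split.
  by apply: expect_ge0 => x; exact: expR_ge0.
exact: (expect_expR_le (t i) (bf i) (fM i)).
Qed.

End bernstein.

(** * Monotone domination of the scores of a unimodal family *)

Section envelope.
Context {R : realType}.
Local Notation T := (measurableTypeR R).
Variables (q b : density R) (m : R).
Hypothesis q_incr : {in `]-oo, m[ &, {homo q : x y / x <= y}}.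
Hypothesis q_decr : {in `]m, +oo[ &, {homo q : x y /~ x <= y}}.

Let f g (x : T) := psi_ratio (translate q g x) (b x).

(* [f] rises for [g < x - m] and falls for [g > x - m]. Reflecting the falling
   part, and leaving room for the unconstrained value at the mode, gives a
   monotone function whose increments dominate those of [f]. *)
Definition variation (g : R) (x : T) : R :=
  if g < x - m then f g x else if g <= x - m then 3 else 6 - f g x.

Let f_bound g x : -1 <= f g x <= 1.
Proof. by rewrite -ler_norml; apply: normr_psi_ratio_le1; exact: pdf_ge0. Qed.

Lemma variation_bound g x : -1 <= variation g x <= 7.
Proof.
rewrite /variation; case: ifP => _; first by have := f_bound g x; lra.
by case: ifP => _; have := f_bound g x; lra.
Qed.

(** On either branch the increments of [variation] are those of [f] up to sign. Between branches the
    ranges [[-1, 1]], [{3}] and [[5, 7]] are at least [2] apart, the largest possible difference of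
    two scores. *)
Lemma variation_increment g g' x : g <= g' ->
  `|f g x - f g' x| <= variation g' x - variation g x.
Proof.
move=> gg'; have := f_bound g x; have := f_bound g' x; rewrite /variation ler_norml.
have [g'x|xg'] := ltP g' (x - m).
  rewrite (le_lt_trans gg' g'x).
  suff : f g x <= f g' x by lra.
  apply: psi_ratio_nondecreasing; [exact: pdf_ge0|exact: pdf_ge0|].
  by rewrite !translateE; apply: q_decr; rewrite ?in_itv/= ?andbT; lra.
have [gx|xg] := ltP g (x - m); first by case: ifP => _; lra.
have [g'x|xg'2] := leP g' (x - m).
  have E : g' = g by apply/eqP; rewrite eq_le; apply/andP; split; lra.
  by rewrite -E g'x; lra.
have [gx|xg2] := leP g (x - m); first by lra.
suff : f g' x <= f g x by lra.
apply: psi_ratio_nondecreasing; [exact: pdf_ge0|exact: pdf_ge0|].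
by rewrite !translateE; apply: q_incr; rewrite ?in_itv/=; lra.
Qed.

Lemma bounded_measurable_variation g : bounded_measurable (variation g).
Proof.
split.
  have mf := (bounded_measurable_psi_ratio (translate q g) b).1.
  have mx : measurable_fun setT (fun x : T => x - m) by exact: measurable_funB.
  apply: measurable_fun_ifT => //; first exact: measurable_fun_ltr.
  apply: measurable_fun_ifT => //; first exact: measurable_fun_ler.
  exact: measurable_funB.
exists 7 => x; have := variation_bound g x; rewrite ler_norml; lra.
Qed.

Lemma expect_variation_bound (s : density R) g : -1 <= expect s (variation g) <= 7.
Proof.
have bv := bounded_measurable_variation g.
have bc (c : R) : @bounded_measurable R (fun=> c) := bounded_measurable_cst c.
apply/andP; split.
  rewrite -[leLHS](expect_cst s); apply: le_expect => // x.
  by case/andP: (variation_bound g x).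
rewrite -[leRHS](expect_cst s); apply: le_expect => // x.
by case/andP: (variation_bound g x).
Qed.

Lemma expect_variation_nondecreasing (s : density R) g g' : g <= g' ->
  expect s (variation g) <= expect s (variation g').
Proof.
move=> gg'; apply: le_expect; try exact: bounded_measurable_variation.
by move=> x; rewrite -subr_ge0 (le_trans _ (variation_increment x gg')).
Qed.

End envelope.

(** The half-line where [beta] holds may be closed, but on finitely many points a strict threshold
    cuts out the same set, and [subgraph] is defined by a strict inequality. *)
Lemma upclosed_threshold (R : realType) N (a : 'I_N -> R) (beta : R -> bool) :
  (forall u v, u <= v -> beta u -> beta v) ->
  exists c, forall j, beta (a j) = (c < a j).
Proof.
(* [low] lies below every [a j], which serves when [beta] holds at all of them. *)
move=> mono; pose low := - \sum_j `|a j| - 1.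
exists (\big[Num.max/low]_(j | ~~ beta (a j)) a j) => j; apply/idP/idP => [bj|].
  apply/bigmax_ltP; split => [|l nbl].
    have := ler_norm (- a j); rewrite normrN /low (bigD1 j)//=.
    have : 0 <= \sum_(i < N | i != j) `|a i| by apply: sumr_ge0.
    lra.
  by rewrite ltNge; apply: contra nbl => /mono; exact.
by move=> cj; apply: contraTT cj => nbj; rewrite -leNgt; exact: le_bigmax_cond.
Qed.

(** * Envelope of the scores close to a reference score *)

Section domination.
Context {R : realType}.
Local Notation T := (measurableTypeR R).
Variables (d : density R) (f f0 D : T -> R) (sigma lambda : R).
Hypotheses (bf : bounded_measurable f) (bf0 : bounded_measurable f0)
  (bD : bounded_measurable D).
Hypotheses (f1 : forall x, `|f x| <= 1) (f01 : forall x, `|f0 x| <= 1)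
  (D8 : forall x, 0 <= D x <= 8) (ffD : forall x, `|f x - f0 x| <= D x).
Hypotheses (sigma1 : sigma ^+ 2 = 1) (lambda0 : 0 < lambda).
Let h x := sigma * f0 x + D x.

Let bh : bounded_measurable h.
Proof. by apply: bounded_measurableD => //; exact: bounded_measurableZ. Qed.

Let signP : sigma = 1 \/ sigma = -1.
Proof.
have : (sigma - 1) * (sigma + 1) = 0 by move: sigma1; rewrite expr2; lra.
by move/eqP; rewrite mulf_eq0 => /orP[/eqP|/eqP] H; [left|right]; lra.
Qed.

Lemma upper_envelope_bound x : `|h x| <= 9.
Proof.
have := f01 x; have := D8 x; rewrite /h !ler_norml.
by case: signP => ->; lra.
Qed.

(** Three comparisons: [sigma * f <= h], [E h <= sigma * E f + 2 E D] and
    [E h^2 <= 2 E f^2 + 20 E D]. The last one is why the compensator of [f] carries [4] where that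
    of [h] carries [2]. *)
Lemma upper_envelope_domination x :
  lambda * (sigma * (f x - expect d f))
    - 4 * lambda ^+ 2 * expect d (fun x => f x ^+ 2) <=
  lambda * (h x - expect d h) - 2 * lambda ^+ 2 * expect d (fun x => h x ^+ 2)
    + (2 * lambda + 40 * lambda ^+ 2) * expect d D.
Proof.
have b2 := bounded_measurableX 2 bf.
have fh : sigma * f x <= h x.
  by have := ffD x; rewrite /h ler_norml; case: signP => ->; lra.
have Eh : expect d h <= sigma * expect d f + 2 * expect d D.
  rewrite -!expectZ// -expectD; [|exact: bounded_measurableZ..].
  apply: le_expect => //.
    by apply: bounded_measurableD; exact: bounded_measurableZ.
  by move=> y; have := ffD y; rewrite /h ler_norml; case: signP => ->; lra.
have Eh2 : expect d (fun x => h x ^+ 2) <=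
    2 * expect d (fun x => f x ^+ 2) + 20 * expect d D.
  rewrite -!expectZ// -expectD; [|exact: bounded_measurableZ..].
  apply: le_expect; first exact: bounded_measurableX.
    by apply: bounded_measurableD; exact: bounded_measurableZ.
  move=> y; have := ffD y; have := f1 y; have := f01 y; have := D8 y.
  rewrite /h !ler_norml => /andP[D0 D8y] /andP[? ?] /andP[? ?] /andP[? ?].
  have H1 : f0 y ^+ 2 <= f y ^+ 2 + 2 * D y by rewrite !expr2; nra.
  have H2 : D y ^+ 2 <= 8 * D y by rewrite !expr2; nra.
  have H3 : (sigma * f0 y + D y) ^+ 2 <= 2 * f0 y ^+ 2 + 2 * D y ^+ 2.
    have := sqr_ge0 (sigma * f0 y - D y); rewrite sqrrB sqrrD exprMn sigma1.
    lra.
  lra.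
have l2 : 0 < lambda ^+ 2 by rewrite exprn_gt0.
have H1 := ler_wpM2l (ltW lambda0) fh.
have H2 := ler_wpM2l (ltW lambda0) Eh.
have H3 := ler_wpM2l (ltW l2) Eh2.
lra.
Qed.

End domination.

(** * Resolution of the levels and number of patterns *)

Section counting.
Context {R : realType} {n V : nat}.
Hypotheses (n_gt0 : (0 < n)%N) (V_gt0 : (0 < V)%N).

Definition penalty : R := V%:R * (1 + log_plus (n%:R / V%:R)).
(** [K] is the number of levels per coordinate: above [n / V], so that [n] oscillations of order
    [1 / K] add up to order [V]; at most [n / V + 1], so that [n * K] points carry few patterns. *)
Lemma exists_resolution : exists K : nat,
  n%:R / V%:R < K%:R :> R /\ K%:R <= n%:R / V%:R + 1 :> R.
Proof.
have /andP[H1 H2] := truncn_itv (divr_ge0 (ler0n R n) (ler0n R V)).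
by exists (Num.truncn (n%:R / V%:R : R)).+1; rewrite -[in X in _ /\ X]natr1 lerD2r.
Qed.

Lemma log_plus_ge0 (x : R) : 0 <= log_plus x.
Proof. by rewrite le_max lexx orbT. Qed.

Lemma penalty_ge : V%:R <= penalty.
Proof. by rewrite /penalty ler_peMr// lerDl log_plus_ge0. Qed.

(** Take [x = u^2] with [u = expR (- l) = min(1, V / n)]. Then [x ^+ V = expR (- 2 V l)], and [(1 +
    x)^(n K) <= expR (n K u^2) <= expR (2 V)] because [u n / V <= 1] and [u K <= 2]. *)
Lemma count_le_expR (K : nat) (N : R) : K%:R <= n%:R / V%:R + 1 :> R ->
  (forall x, 0 < x -> x <= 1 -> N * x ^+ V <= (1 + x) ^+ (n * K)) ->
  N <= expR (2 * penalty).
Proof.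
move=> KnV; set l := log_plus (n%:R / V%:R : R).
pose u := expR (- l); pose a : R := n%:R / V%:R.
have u0 : 0 < u by exact: expR_gt0.
have u1 : u <= 1 by rewrite expR_le1 oppr_le0 log_plus_ge0.
have a0 : 0 < a by rewrite divr_gt0 ?ltr0n.
have ua : u * a <= 1.
  rewrite -ler_pdivlMr// div1r -[leRHS]lnK ?posrE ?invr_gt0//.
  by rewrite ler_expR lnV// lerN2 le_max lexx.
have x0 : 0 < u ^+ 2 by rewrite exprn_gt0.
have x1 : u ^+ 2 <= 1 by rewrite exprn_ile1// ltW.
move=> /(_ _ x0 x1) H.
have xV : (u ^+ 2) ^+ V = expR (- (2 * (V%:R * l))).
  by rewrite -!expRM_natl; congr expR; ring.
have V0 : 0 < V%:R :> R by rewrite ltr0n.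
have nE : n%:R = a * V%:R :> R by rewrite divfK// gt_eqF.
have H2 : (1 + u ^+ 2) ^+ (n * K) <= expR (2 * V%:R).
  apply: (@le_trans _ _ (expR (u ^+ 2) ^+ (n * K))).
    rewrite lerXn2r ?nnegrE ?expR_ge0 ?addr_ge0 ?sqr_ge0//.
    exact: expR_ge1Dx.
  rewrite -expRM_natl ler_expR natrM nE.
  have Ka : K%:R <= a + 1 := KnV.
  have Kp : 0 <= K%:R :> R by [].
  have -> : a * V%:R * K%:R * u ^+ 2 = V%:R * ((u * a) * (u * K%:R)) by ring.
  rewrite [leRHS]mulrC ler_pM2l//.
  have : u * K%:R <= 2 by nra.
  have : 0 <= u * a by rewrite mulr_ge0// ltW.
  nra.
move: (le_trans H H2); rewrite xV expRN ler_pdivrMr ?expR_gt0// -expRD => {}H.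
by apply: le_trans H _; rewrite ler_expR /penalty -/l; lra.
Qed.

End counting.

Lemma vc_index_gt0 (T : Type) (C : set (set T)) V :
  C !=set0 -> vc_index C V -> (0 < V)%N.
Proof.
move=> [c Cc] [H _]; rewrite lt0n; apply/eqP => V0; rewrite V0 in H.
apply: (H set0); first by rewrite II0 card_eq00.
by move=> B; rewrite subset0 => ->; exists c => //; rewrite setI0.
Qed.

(** Were the gap larger than [8 / K], the first level strictly above [a] would be at most [a'],
    hence among the [K] levels since [a' <= 7], and would separate [a] from [a']. *)
Lemma levels_close (R : realType) (K : nat) (a a' : R) : (0 < K)%N ->
  -1 <= a -> a' <= 7 ->
  (forall k : 'I_K, (-1 + k.+1%:R * (8 / K%:R) <= a) =
                    (-1 + k.+1%:R * (8 / K%:R) <= a')) ->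
  a' - a <= 8 / K%:R.
Proof.
move=> K0 a1 a7 aa'; rewrite leNgt; apply/negP => H.
have e0 : 0 < 8 / K%:R :> R by rewrite divr_gt0// ltr0n.
have y0 : 0 <= (a + 1) / (8 / K%:R) by rewrite divr_ge0// ?(ltW e0)//; lra.
have /andP[] := truncn_itv y0; set k := Num.truncn _.
rewrite ler_pdivlMr// ltr_pdivrMr// => k1 k2.
have kE : k.+1%:R * (8 / K%:R) < 8 :> R by rewrite -natr1 mulrDl mul1r; lra.
have kK : (k < K)%N.
  move: kE; rewrite mulrCA gtr_pMr// ltr_pdivrMr ?ltr0n// mul1r ltr_nat.
  exact: ltnW.
have := aa' (Ordinal kK) => /= aE.
have : -1 + k.+1%:R * (8 / K%:R) <= a' by rewrite -natr1 mulrDl mul1r; lra.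
by rewrite -aE; lra.
Qed.

Lemma measurable_bigmaxr (R : realType) d (T : measurableType d) I (r : seq I)
    (h : I -> T -> R) : (forall i, measurable_fun setT (h i)) ->
  measurable_fun setT (fun x => \big[Num.max/0]_(i <- r) h i x).
Proof.
move=> mh; elim: r => [|i r IH].
  under eq_fun do rewrite big_nil.
  exact: measurable_cst.
under eq_fun do rewrite big_cons.
exact: measurable_maxr.
Qed.

(** * Exponential moment of the supremum over the class *)

Section exponential_moment.
Context {R : realType} {n V : nat}.
Local Notation T := (measurableTypeR R).
Local Notation sample := (n.-tuple T).
Variables (q : density R) (m : R) (F : set 'rV[R]_n) (s sbar : L0 R n).
Hypothesis q_incr : {in `]-oo, m[ &, {homo q : x y / x <= y}}.
Hypothesis q_decr : {in `]m, +oo[ &, {homo q : x y /~ x <= y}}.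
Hypothesis F_neq0 : F !=set0.
Hypothesis vcF : vc_subgraph (as_functions F) V.
Hypothesis n_gt0 : (0 < n)%N.
Local Notation pen := (@penalty R n V).

Variable K : nat.
Hypotheses (K_gt : n%:R / V%:R < K%:R :> R)
  (K_le : K%:R <= n%:R / V%:R + 1 :> R).

Let K_gt0 : (0 < K)%N.
Proof. by rewrite -(ltr0n R) (le_lt_trans _ K_gt)// divr_ge0. Qed.

Let V_gt0 : (0 < V)%N.
Proof.
apply: vc_index_gt0 vcF; have [g Fg] := F_neq0.
by exists (subgraph (g ord0)); exists (g ord0) => //; exists g.
Qed.

Let f i c (x : T) := psi_ratio (translate q c x) (sbar i x).
Let W i c := variation q (sbar i) m c.
Let G i c := expect (s i) (W i c).
Let bit i (k : 'I_K) c := -1 + k.+1%:R * (8 / K%:R) <= G i c.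

Let Wle i c c' : c <= c' -> forall x, W i c x <= W i c' x.
Proof.
move=> cc' x; rewrite -subr_ge0.
exact: le_trans (variation_increment (sbar i) q_incr q_decr x cc').
Qed.

Let bits_close i c c' : (forall k, bit i k c = bit i k c') ->
  G i c' - G i c <= 8 / K%:R.
Proof.
move=> bb; apply: levels_close (bb) => //.
  by have /andP[] := expect_variation_bound q (sbar i) m (s i) c.
by have /andP[] := expect_variation_bound q (sbar i) m (s i) c'.
Qed.

Let cls (g : 'rV[R]_n) : {set 'I_n * 'I_K} :=
  [set ik | bit ik.1 ik.2 (g ord0 ik.1)]%SET.

(** Each bit is monotone in the coordinate, so on the given vectors it reads [c < g_i], that is,
    [(i, c)] lies in the subgraph of [g]. Classes are thus patterns of subgraphs on [n * K]
    points. *)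
Let card_classes N (gs : 'I_N -> 'rV[R]_n) : (forall j, F (gs j)) ->
  #|[set cls (gs j) | j : 'I_N]%SET|%:R <= expR (2 * pen).
Proof.
move=> Fgs; apply: (count_le_expR n_gt0 V_gt0 K_le) => x x0 x1.
have /choice[c cE] : forall ik : 'I_n * 'I_K, exists c, forall j,
    bit ik.1 ik.2 (gs j ord0 ik.1) = (c < gs j ord0 ik.1).
  move=> ik.
  apply: (upclosed_threshold (fun j => gs j ord0 ik.1)) => u v uv bu.
  apply: le_trans bu _; exact: expect_variation_nondecreasing.
have := card_patterns_le (pt := fun ik => (ik.1, c ik)) vcF _ x0 x1.
rewrite card_prod !card_ord; apply => A /imsetP[j _ ->].
exists (subgraph (gs j ord0)); first by exists (gs j ord0) => //; exists (gs j).
by move=> ik; rewrite finset.inE cE.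
Qed.

Variables (sigma lambda : R).
Hypotheses (sigma1 : sigma ^+ 2 = 1) (lambda0 : 0 < lambda)
  (lambda1 : lambda <= 36^-1).

(** The sign [sigma] selects the tail. The compensator is twice that of [integral_law_expR_le1]; the
    excess is spent in [upper_envelope_domination]. *)
Definition exp_deviation (g : 'rV[R]_n) (X : sample) : R :=
  expR (\sum_(i < n) (lambda * (sigma * (f i (g ord0 i) (tnth X i)
                                         - expect (s i) (f i (g ord0 i))))
       - 4 * lambda ^+ 2 * expect (s i) (fun x => f i (g ord0 i) x ^+ 2))).

Let bf i c : bounded_measurable (f i c).
Proof. exact: bounded_measurable_psi_ratio. Qed.

Lemma measurable_exp_deviation g : measurable_fun setT (exp_deviation g).
Proof.
apply: measurableT_comp => //; apply: measurable_sum => i.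
apply: measurable_funB => //; apply: measurable_funM => //.
apply: measurable_funM => //; apply: measurable_funB => //.
apply: (measurableT_comp (bf i _).1); exact: measurable_tnth.
Qed.

(** All members of a class lie within [D] of a representative, coordinate by coordinate, so a single
    sum of independent bounded variables dominates their exponents, at the price of [pen]. *)
Let class_envelope N (gs : 'I_N -> 'rV[R]_n) (A : {set 'I_n * 'I_K}) :
  exists Y : sample -> R, [/\ measurable_fun setT Y, forall X, 0 <= Y X,
    (\int[law s]_X (Y X)%:E <= (expR pen)%:E)%E &
    forall j X, cls (gs j) = A -> exp_deviation (gs j) X <= Y X].
Proof.
have [j0 /eqP j0A|noj] := pickP (fun j => cls (gs j) == A); last first.
  exists (fun=> 0); split => //.
    by rewrite integral0 lee_fin expR_ge0.
  by move=> j X /eqP; rewrite noj.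
(* The extremes of a coordinate may be attained at different members for different [i]. Both ends
   still have the bits of [A], which suffices for [expect (s i) (D i) <= 8 / K]. *)
pose lo i := gs [arg min_(j < j0 | cls (gs j) == A) gs j ord0 i]%O ord0 i.
pose hi i := gs [arg max_(j > j0 | cls (gs j) == A) gs j ord0 i]%O ord0 i.
have loP i : (exists2 j, cls (gs j) = A & lo i = gs j ord0 i) /\
    forall j, cls (gs j) = A -> lo i <= gs j ord0 i.
  rewrite /lo; case: arg_minP => [|j /eqP jA jmin]; first exact/eqP.
  by split; [exists j|move=> l /eqP lA; exact: jmin].
have hiP i : (exists2 j, cls (gs j) = A & hi i = gs j ord0 i) /\
    forall j, cls (gs j) = A -> gs j ord0 i <= hi i.
  rewrite /hi; case: arg_maxP => [|j /eqP jA jmax]; first exact/eqP.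
  by split; [exists j|move=> l /eqP lA; exact: jmax].
pose D i x := W i (hi i) x - W i (lo i) x.
have bD i : bounded_measurable (D i).
  by apply: bounded_measurableB; exact: bounded_measurable_variation.
have D8 i x : 0 <= D i x <= 8.
  have loh : lo i <= hi i.
    by have [_ /(_ _ j0A) h1] := loP i; have [_ /(_ _ j0A)] := hiP i; exact: le_trans.
  have h1 : -1 <= W i (hi i) x <= 7 := variation_bound q (sbar i) m (hi i) x.
  have h2 : -1 <= W i (lo i) x <= 7 := variation_bound q (sbar i) m (lo i) x.
  have h3 := Wle i loh x.
  rewrite /D; move: h1 h2 h3; move: (W i (hi i) x) (W i (lo i) x) => u v; lra.
have ED i : expect (s i) (D i) <= 8 / K%:R.
  rewrite expectB; [|exact: bounded_measurable_variation..].
  apply: bits_close => k.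
  have [[j jA ->] _] := loP i; have [[l lA ->] _] := hiP i.
  have : (i, k) \in cls (gs j) = ((i, k) \in cls (gs l)) by rewrite jA lA.
  rewrite [LHS]finset.in_set [RHS]finset.in_set => jl; exact: jl.
have ED0 i : 0 <= expect (s i) (D i).
  by apply: expect_ge0 => x; case/andP: (D8 i x).
have fD i j l x : cls (gs j) = A -> cls (gs l) = A ->
    `|f i (gs j ord0 i) x - f i (gs l ord0 i) x| <= D i x.
  move=> jA lA; have [_ lo_le] := loP i; have [_ hi_ge] := hiP i.
  wlog le_jl : j l jA lA / gs j ord0 i <= gs l ord0 i.
    move=> H; have [|/ltW] := leP (gs j ord0 i) (gs l ord0 i); first exact: H.
    by rewrite distrC; exact: H.
  apply: le_trans (variation_increment (sbar i) q_incr q_decr x le_jl) _.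
  by apply: lerB; apply: Wle; [exact: hi_ge|exact: lo_le].
pose h i x := sigma * f i (gs j0 ord0 i) x + D i x.
have f1 i c x : `|f i c x| <= 1.
  by apply: normr_psi_ratio_le1; exact: pdf_ge0.
have bh i : bounded_measurable (h i).
  by apply: bounded_measurableD => //; exact: bounded_measurableZ.
have h9 i x : `|h i x| <= 9.
  by apply: upper_envelope_bound; [exact: f1|exact: D8|exact: sigma1].
pose Z X := expR (\sum_(i < n) (lambda * (h i (tnth X i) - expect (s i) (h i))
  - 2 * lambda ^+ 2 * expect (s i) (fun x => h i x ^+ 2))).
have mZ : measurable_fun setT Z.
  apply: measurableT_comp => //; apply: measurable_sum => i.
  apply: measurable_funB => //; apply: measurable_funM => //.
  apply: measurable_funB => //.
  apply: (measurableT_comp (bh i).1); exact: measurable_tnth.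
have KV : n%:R / K%:R <= V%:R :> R.
  move: K_gt; rewrite ltr_pdivrMr ?ltr0n// ler_pdivrMr ?ltr0n// mulrC => /ltW.
  by [].
exists (fun X => expR pen * Z X); split.
- exact: measurable_funM.
- by move=> X; rewrite mulr_ge0 ?expR_ge0.
- under eq_integral do rewrite EFinM.
  rewrite ge0_integralZl_EFin ?expR_ge0//; last 2 first.
  + by move=> X _; rewrite lee_fin expR_ge0.
  + exact/measurable_EFinP.
  rewrite -[leRHS]mule1 lee_pmul2l ?lte_fin ?expR_gt0//.
  apply: (integral_law_expR_le1 s bh h9 lambda0).
  have l1 : lambda * 36 <= 1 by rewrite -ler_pdivlMr// mul1r.
  by lra.
- move=> j X jA; rewrite -expRD ler_expR -lerBlDr.
  (* The total cost is [(16 lambda + 320 lambda^2) * n / K], at most [n / K <= V] because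
     [lambda <= 1/36]. *)
  apply: (@le_trans _ _ (\sum_(i < n) ((2 * lambda + 40 * lambda ^+ 2)
      * (8 / K%:R)))); last first.
    rewrite sumr_const card_ord -[leLHS]mulr_natl.
    have -> : n%:R * ((2 * lambda + 40 * lambda ^+ 2) * (8 / K%:R)) =
      (16 * lambda + 320 * lambda ^+ 2) * (n%:R / K%:R) by ring.
    apply: (@le_trans _ _ V%:R); last exact: penalty_ge.
    apply: (le_trans _ KV); apply: ler_piMl; first by rewrite divr_ge0.
    have l1 : lambda * 36 <= 1 by rewrite -ler_pdivlMr// mul1r.
    have l2 : lambda * (lambda * 36) <= lambda * 1 by rewrite ler_pM2l.
    by rewrite expr2; lra.
  rewrite lerBlDr -big_split/=; apply: ler_sum => i _.
  have := upper_envelope_domination (s i) (bf i (gs j ord0 i)) (bf i (gs j0 ord0 i))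
    (bD i) (f1 i _) (f1 i _) (D8 i) (fun x => fD i j j0 x jA j0A) sigma1 lambda0 (tnth X i).
  move/le_trans; apply; rewrite [leRHS]addrC lerD2l; apply: ler_wpM2l; last exact: ED.
  by rewrite addr_ge0// mulr_ge0// ?sqr_ge0// ltW.
Qed.

(** Union bound: at most [expR (2 * pen)] classes occur, and the envelope of each has integral at
    most [expR pen]. *)
Lemma integral_bigmax_exp_deviation N (gs : 'I_N -> 'rV[R]_n) :
  (forall j, F (gs j)) ->
  (\int[law s]_X (\big[Num.max/0]_(j < N) exp_deviation (gs j) X)%:E
    <= (expR (3 * pen))%:E)%E.
Proof.
move=> Fgs; set P := [set cls (gs j) | j : 'I_N]%SET.
have /choice[Y YP] := class_envelope gs.
apply: (@le_trans _ _ (\int[law s]_X (\sum_(A in P) Y A X)%:E)%E).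
  apply: ge0_le_integral => //.
  - by move=> X _; rewrite lee_fin bigmax_ge_id.
  - apply/measurable_EFinP; apply: measurable_bigmaxr => j.
    exact: measurable_exp_deviation.
  - apply/measurable_EFinP; under eq_fun do rewrite -big_enum.
    apply: measurable_sum => A.
    by have [+ _ _ _] := YP A.
  - move=> X _; rewrite lee_fin; apply: bigmax_le.
      by apply: sumr_ge0 => A _; have [_ + _ _] := YP A; exact.
    move=> j _; have jP : cls (gs j) \in P by apply/imsetP; exists j.
    rewrite (bigD1 (cls (gs j)))//=.
    have [_ _ _ H] := YP (cls (gs j)).
    apply: (le_trans (H j X erefl)); rewrite lerDl sumr_ge0// => A _.
    by have [_ + _ _] := YP A; exact.
under eq_integral do rewrite -big_enum -sumEFin.
rewrite ge0_integral_sum//; last 2 first.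
- by move=> A; apply/measurable_EFinP; have [+ _ _ _] := YP A.
- by move=> A X _; rewrite lee_fin; have [_ + _ _] := YP A; exact.
apply: (@le_trans _ _ (\sum_(A <- enum P) (expR pen)%:E)%E).
  by apply: lee_sum => A _; have [_ _ + _] := YP A.
rewrite sumEFin lee_fin big_enum sumr_const -[leLHS]mulr_natl.
have -> : expR (3 * pen) = expR (2 * pen) * expR pen.
  by rewrite -expRD; congr expR; ring.
by rewrite ler_pM2r ?expR_gt0//; exact: card_classes.
Qed.

(** The bound on finite maxima is uniform in [N], so it passes to the supremum by monotone
    convergence. *)
Lemma integral_sup_exp_deviation (gs : nat -> 'rV[R]_n) :
  (forall j, F (gs j)) ->
  (\int[law s]_X ereal_sup (range (fun j => (exp_deviation (gs j) X)%:E))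
    <= (expR (3 * pen))%:E)%E.
Proof.
move=> Fgs.
pose M N X : R := \big[Num.max/0]_(j < N) exp_deviation (gs j) X.
have M0 N X : 0 <= M N X by exact: bigmax_ge_id.
have MS X : {homo (fun N => (M N X)%:E) : a b / (a <= b)%N >-> (a <= b)%E}.
  move=> a b ab; rewrite lee_fin; apply: bigmax_le => // j _.
  exact: (le_bigmax _ (fun j : 'I_b => exp_deviation (gs j) X) (widen_ord ab j)).
have mM N : measurable_fun setT (fun X => (M N X)%:E).
  apply/measurable_EFinP; apply: measurable_bigmaxr => j.
  exact: measurable_exp_deviation.
have supE X : ereal_sup (range (fun j => (exp_deviation (gs j) X)%:E)) =
    limn (fun N => (M N X)%:E).
  apply/esym/cvg_lim => //.
  have -> : ereal_sup (range (fun j => (exp_deviation (gs j) X)%:E)) =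
      ereal_sup (range (fun N => (M N X)%:E)).
    apply/eqP; rewrite eq_le; apply/andP; split; apply: ub_ereal_sup.
      move=> _ [j _ <-]; apply: (@le_trans _ _ (M j.+1 X)%:E).
        rewrite lee_fin.
        exact: (le_bigmax _ (fun i : 'I_j.+1 => exp_deviation (gs i) X) ord_max).
      by apply: ereal_sup_ubound; exists j.+1.
    move=> _ [N _ <-].
    have jS j : ((exp_deviation (gs j) X)%:E <=
        ereal_sup (range (fun j => (exp_deviation (gs j) X)%:E)))%E.
      by apply: ereal_sup_ubound; exists j.
    rewrite /M; elim/big_ind : _ => [|x y x0 y0|j _]; last exact: jS.
      by apply: le_trans (jS 0%N); rewrite lee_fin expR_ge0.
    by rewrite /Num.max; case: ifP.
  by apply: ereal_nondecreasing_cvgn; exact: MS.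
under eq_integral do rewrite supE.
rewrite monotone_convergence//; last first.
  by move=> N X _; rewrite lee_fin.
apply: lime_le.
  apply: ereal_nondecreasing_is_cvgn => a b ab.
  apply: ge0_le_integral => //.
  - by move=> X _; rewrite lee_fin.
  - by move=> X _; exact: MS.
by apply: nearW => N; apply: integral_bigmax_exp_deviation => j; exact: Fgs.
Qed.

End exponential_moment.

(** * Deviations of rho-estimators *)

Lemma countable_range (T : Type) (S : set T) (t0 : T) : countable S -> S t0 ->
  exists e : nat -> T, range e = S.
Proof.
move=> /countable_injP[f finj] St0.
have /choice[e eP] : forall k : nat, exists t, S t /\ forall u, S u -> f u = k -> t = u.
  move=> k; have [[u [Su fu]]|no] := pselect (exists u, S u /\ f u = k).
    exists u; split => // v Sv fv; apply: finj; rewrite ?inE//.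
    by rewrite fu fv.
  by exists t0; split => // u Su fu; exfalso; apply: no; exists u.
exists e; apply/seteqP; split => [_ [k _ <-]|t St]; first by case: (eP k).
by exists (f t) => //; case: (eP (f t)) => _; exact.
Qed.

Section hellinger_L0.
Context {R : realType} {n : nat}.
Implicit Types s t u : L0 R n.

Lemma hell2_ge0 s t : 0 <= hell2 s t.
Proof. by apply: sumr_ge0 => i _; exact: h2_ge0. Qed.

Lemma sqr_hell s t : hell s t ^+ 2 = hell2 s t.
Proof. by rewrite sqr_sqrtr// hell2_ge0. Qed.

Lemma hell_ge0 s t : 0 <= hell s t. Proof. exact: sqrtr_ge0. Qed.

Lemma hell2C s t : hell2 s t = hell2 t s.
Proof. by apply: eq_bigr => i _; rewrite h2C. Qed.

Lemma hell2_triangle s t u : hell2 s u <= 2 * hell2 s t + 2 * hell2 t u.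
Proof.
by rewrite !mulr_sumr -big_split/=; apply: ler_sum => i _; exact: h2_triangle.
Qed.

Lemma hell_dist_ge0 s (S : set (L0 R n)) : (0 <= hell_dist s S)%E.
Proof. by apply: le_ereal_inf_tmp => _ [u _ <-]; rewrite lee_fin hell_ge0. Qed.

Lemma hell_dist_fin s (S : set (L0 R n)) : S !=set0 ->
  hell_dist s S \is a fin_num.
Proof.
move=> [u Su]; rewrite ge0_fin_numE ?hell_dist_ge0//.
apply: (@le_lt_trans _ _ (hell s u)%:E); last exact: ltry.
by apply: ereal_inf_lbound; exists u.
Qed.

Lemma psi_sqrt_ratioE s t i X :
  psi_sqrt_ratio s t i X = psi_ratio (t i (tnth X i)) (s i (tnth X i)).
Proof. by apply: psi_sqrte_ratio; exact: pdf_ge0. Qed.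

Lemma stat_TC X s t : stat_T X s t = - stat_T X t s.
Proof.
rewrite /stat_T /= opprD -!mulrN -!sumrN; congr (_ * _ + _ * _); apply: eq_bigr => i _.
  rewrite opprB; congr (affinity _ _ - affinity _ _);
    by apply/funext => x; rewrite addrC.
by rewrite !psi_sqrt_ratioE psi_ratioC.
Qed.

(** The mean comes from [expect_test_le]. As [24 * lambda <= 1/10], the compensator adds at most
    [w / 10] times the distances, and for [w < 71/100] one has [1 + w + w / 10 <= 2] and
    [1 - w - w / 10 >= 1/5]. *)
Lemma stat_T_le X s t t' (lambda a : R) : 0 < lambda -> lambda <= 240^-1 ->
  \sum_(i < n) (lambda * (psi_ratio (t' i (tnth X i)) (t i (tnth X i))
        - expect (s i) (fun x => psi_ratio (t' i x) (t i x)))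
     - 4 * lambda ^+ 2 * expect (s i) (fun x => psi_ratio (t' i x) (t i x) ^+ 2))
    <= a ->
  0 <= a ->
  stat_T X t t' <= 2 * hell2 s t - 5^-1 * hell2 s t' + a / lambda.
Proof.
move=> l0 l1 Ha a0.
pose w : R := (Num.sqrt 2)^-1.
have w0 : 0 < w := @sqrt2V_gt0 R.
have w1 : w < 71 / 100 := @sqrt2V_lt R.
have l24 : 24 * lambda <= 10^-1.
  rewrite -(@ler_pdivlMl _ 24)// (le_trans l1)//.
  lra.
have al : 0 <= a / lambda by rewrite divr_ge0// ltW.
pose Z := \sum_(i < n) (psi_ratio (t' i (tnth X i)) (t i (tnth X i))
        - expect (s i) (fun x => psi_ratio (t' i x) (t i x))
     - 4 * lambda * expect (s i) (fun x => psi_ratio (t' i x) (t i x) ^+ 2)).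
have Za : Z <= a / lambda.
  rewrite ler_pdivlMr// mulrC mulr_sumr (le_trans _ Ha)//.
  by apply: ler_sum => i _; rewrite le_eqVlt; apply/orP; left; apply/eqP; ring.
have -> : stat_T X t t' = \sum_(i < n) (2^-1 *
   (affinity (t' i) (fun x => (t i x + t' i x) / 2) - affinity (t i) (fun x => (t i x + t' i x) / 2))
   + w * psi_ratio (t' i (tnth X i)) (t i (tnth X i))).
  rewrite big_split/= -!mulr_sumr; congr (_ + _ * _).
  by apply: eq_bigr => i _; rewrite psi_sqrt_ratioE.
have wZ : w * Z <= a / lambda.
  apply: le_trans (ler_wpM2l (ltW w0) Za) _; apply: ler_piMl => //; lra.
have -> : 2 * hell2 s t - 5^-1 * hell2 s t' =
    \sum_(i < n) (2 * h2 (s i) (t i) - 5^-1 * h2 (s i) (t' i)).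
  by rewrite sumrB /hell2 !mulr_sumr.
apply: (le_trans _ (lerD (lexx _) wZ)).
rewrite mulr_sumr -big_split/=; apply: ler_sum => i _.
have H1 := expect_test_le (s i) (t i) (t' i).
have H2 := expect_sqr_psi_ratio_le (s i) (t i) (t' i).
have h0 := h2_ge0 (s i) (t i); have h0' := h2_ge0 (s i) (t' i).
rewrite -/w in H1.
move: H1 H2 h0 h0'.
set A := affinity _ _; set B := affinity _ _; set E := expect _ _; set E2 := expect _ _.
set P := psi_ratio _ _; set h := h2 _ _; set h' := h2 _ _ => H1 H2 h0 h0'.
have E2l : 4 * lambda * E2 <= 10^-1 * (h + h').
  have l4 : 0 <= 4 * lambda by lra.
  have := ler_wpM2l l4 H2 => H3.
  have hh : 0 <= h + h' by lra.
  have := ler_wpM2r hh l24.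
  by lra.
have wE : w * (4 * lambda * E2) <= w * (10^-1 * (h + h')) by rewrite ler_pM2l.
have wh : w * h <= 71 / 100 * h by rewrite ler_wpM2r// ltW.
have wh' : w * h' <= 71 / 100 * h' by rewrite ler_wpM2r// ltW.
lra.
Qed.

End hellinger_L0.

Lemma measurable_ereal_sup_range d (T : measurableType d) (R : realType)
    (h : nat -> T -> \bar R) : (forall k, measurable_fun setT (h k)) ->
  measurable_fun setT (fun x => ereal_sup (range (h ^~ x))).
Proof.
move=> mh; rewrite (_ : (fun _ => _) = (fun x => esups (h ^~ x) 0%N)).
  exact: measurable_fun_esups.
apply/funext => x; rewrite /esups; congr ereal_sup; apply/seteqP; split.
  by move=> _ [k _ <-]; exists k.
by move=> _ [k _ <-]; exists k.
Qed.

Section deviation.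
Context {R : realType} {n V : nat}.
Local Notation T := (measurableTypeR R).
Local Notation sample := (n.-tuple T).
Variables (q : density R) (F : set 'rV[R]_n).
Hypothesis unimodal_q : unimodal q.
Hypothesis F_neq0 : F !=set0.
Hypothesis vcF : vc_subgraph (as_functions F) V.
Hypothesis n_gt0 : (0 < n)%N.
Local Notation pen := (@penalty R n V).

Lemma vc_gt0 : (0 < V)%N.
Proof.
apply: vc_index_gt0 vcF; have [g Fg] := F_neq0.
by exists (subgraph (g ord0)); exists (g ord0) => //; exists g.
Qed.

Lemma penalty_ge1 : 1 <= pen.
Proof. by rewrite (le_trans _ penalty_ge)// ler1n vc_gt0. Qed.

Lemma integral_sup_exp_deviation_le (s sbar : L0 R n) (sigma lambda : R)
    (gs : nat -> 'rV[R]_n) : sigma ^+ 2 = 1 -> 0 < lambda -> lambda <= 36^-1 ->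
  (forall j, F (gs j)) ->
  (\int[law s]_X ereal_sup (range (fun j =>
     (exp_deviation q s sbar sigma lambda (gs j) X)%:E))
    <= (expR (3 * pen))%:E)%E.
Proof.
move=> sigma1 l0 l1 Fgs; have [m [incr decr]] := unimodal_q.
have [K [K1 K2]] := @exists_resolution R n V.
exact: (integral_sup_exp_deviation s sbar incr decr F_neq0 vcF n_gt0 K1 K2).
Qed.

(** Markov's inequality for the supremum over the sequence, whose mean is at most [expR (3 * pen)],
    at level [expR (3 * pen + xi)]. The resulting event controls all [gs j] at once. *)
Lemma law_exp_deviation_le (s sbar : L0 R n) (lambda xi : R)
    (gs : nat -> 'rV[R]_n) : 0 < lambda -> lambda <= 36^-1 ->
  (forall j, F (gs j)) ->
  let E := [set X | forall j, exp_deviation q s sbar 1 lambda (gs j) X <= expR (3 * pen + xi)] in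
  measurable E /\ ((1 - expR (- xi))%:E <= law s E)%E.
Proof.
move=> l0 l1 Fgs E; set a := expR (3 * pen + xi).
have a0 : 0 < a by exact: expR_gt0.
pose U X := ereal_sup (range (fun j => (exp_deviation q s sbar 1 lambda (gs j) X)%:E)).
have mU : measurable_fun setT U.
  apply: measurable_ereal_sup_range => k; apply/measurable_EFinP.
  exact: measurable_exp_deviation.
have U0 X : (0 <= U X)%E.
  apply: (@le_trans _ _ (exp_deviation q s sbar 1 lambda (gs 0%N) X)%:E).
    by rewrite lee_fin expR_ge0.
  by apply: ereal_sup_ubound; exists 0%N.
have EE : E = [set X | (U X <= a%:E)%E].
  apply/seteqP; split => X /= H.
    by apply: ub_ereal_sup => _ [j _ <-]; rewrite lee_fin.
  by move=> j; rewrite -lee_fin; apply: le_trans H; apply: ereal_sup_ubound; exists j.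
have mE : measurable E.
  by rewrite EE -[X in measurable X]setTI; apply: emeasurable_fun_infty_c.
split => //.
have H : (law s (~` E) <= (expR (- xi))%:E)%E.
  have := le_integral_abse (law s) measurableT mU a0.
  rewrite setTI => H.
  have {H} : (a%:E * law s (~` E) <= (expR (3 * pen))%:E)%E.
    have s1 : 1 ^+ 2 = 1 :> R by rewrite expr1n.
    apply: le_trans (integral_sup_exp_deviation_le s sbar s1 l0 l1 Fgs).
    apply: le_trans (le_trans H _).
      rewrite lee_pmul2l ?lte_fin//; apply: le_measure; rewrite ?inE.
      - exact: measurableC.
      - rewrite -[X in measurable X]setTI; apply: emeasurable_fun_c_infty => //.
        exact: measurableT_comp.
      - rewrite EE => X /= /negP; rewrite -ltNge => /ltW H1.
        by rewrite gee0_abs.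
    by under eq_integral do rewrite gee0_abs//.
  have fP : law s (~` E) \is a fin_num by apply: fin_num_measure; exact: measurableC.
  rewrite -(fineK fP) -EFinM !lee_fin => H.
  have -> : expR (- xi) = expR (3 * pen) / a by rewrite -expRB; congr expR; ring.
  by rewrite ler_pdivlMr// mulrC.
rewrite -[E]setCK probability_setC; last exact: measurableC.
by rewrite EFinB leeB.
Qed.

End deviation.

Section rho_deviation.
Context {R : realType} {n V : nat}.
Local Notation T := (measurableTypeR R).
Local Notation sample := (n.-tuple T).
Variables (q : density R) (F : set 'rV[R]_n).
Hypothesis unimodal_q : unimodal q.
Hypothesis F_neq0 : F !=set0.
Hypothesis vcF : vc_subgraph (as_functions F) V.
Hypothesis n_gt0 : (0 < n)%N.
Local Notation pen := (@penalty R n V).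
Local Notation Sbar := (shift_model q F).

Lemma countable_shifts (S : set (L0 R n)) : countable S -> S !=set0 ->
  S `<=` Sbar -> exists2 gs : nat -> 'rV[R]_n, forall k, F (gs k) &
    forall t, S t <-> exists k, t = shifts q (gs k).
Proof.
move=> cS [t0 St0] SSbar; have [e eS] := countable_range cS St0.
have Se k : S (e k) by rewrite -eS; exists k.
have /choice[gs gsP] : forall k, exists g, F g /\ shifts q g = e k.
  by move=> k; have [g Fg gE] := SSbar _ (Se k); exists g.
exists gs => [k|t]; first by case: (gsP k).
rewrite -eS; split => [[k _ <-]|[k ->]]; exists k => //; by case: (gsP k).
Qed.

(* [Upsilon(S, sbar)] is small, hence so is
   [Upsilon(S, t) >= T(X, t, sbar) = - T(X, sbar, t)] for a near minimizer [t]. *)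
Lemma near_minimizer_le (S : set (L0 R n)) (X : sample) (s sbar t : L0 R n) (a : R) :
  S sbar -> (forall u, S u ->
    stat_T X sbar u <= 2 * hell2 s sbar - 5^-1 * hell2 s u + a) ->
  near_minimizers X S t -> hell2 s t <= 20 * hell2 s sbar + 10 * a + 357 / 2.
Proof.
move=> Ssbar TS [St tmin].
have U1 : (Upsilon X S sbar <= (2 * hell2 s sbar + a)%:E)%E.
  apply: ub_ereal_sup => _ [u Su <-]; rewrite lee_fin (le_trans (TS u Su))//.
  by rewrite lerD2r gerBl mulr_ge0// hell2_ge0.
have U2 : ((stat_T X t sbar)%:E <= Upsilon X S t)%E.
  by apply: ereal_sup_ubound; exists sbar.
have U3 : (ereal_inf [set Upsilon X S u | u in S] <= Upsilon X S sbar)%E.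
  by apply: ereal_inf_lbound; exists sbar.
(* Antisymmetry turns the chain into [h^2(s, t) / 5 <= 4 h^2(s, sbar) + 2 a + kappa / 10]. *)
have := le_trans U2 (le_trans tmin (leeD2r _ (le_trans U3 U1))).
by rewrite -EFinD lee_fin stat_TC /kappa; have := TS t St; lra.
Qed.

Lemma rho_estimator_deviation (S : set (L0 R n)) (shat : sample -> L0 R n)
    (s : L0 R n) (xi : R) : dense_in S Sbar -> rho_estimator S shat -> 0 < xi ->
  ((1 - expR (- xi))%:E <= law s
    [set X | (20000^-1 * hell2 s (shat X))%:E <=
             hell_dist s Sbar ^+ 2 + (pen + xi)%:E])%E.
Proof.
pose lambda : R := 240^-1.
have l0 : 0 < lambda by rewrite invr_gt0 ltr0n.
have l1 : lambda <= 36^-1 by rewrite lef_pV2 ?posrE ?ltr0n// ler_nat.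
have pen1 : 1 <= pen := penalty_ge1 F_neq0 vcF.
move=> [SSbar dense] [cS _ mshat hE] xi0.
have a0 : 0 <= 3 * pen + xi by lra.
have Sbar0 : Sbar !=set0 by have [g Fg] := F_neq0; exists (shifts q g); exists g.
have dfin := hell_dist_fin s Sbar0.
pose d := fine (hell_dist s Sbar).
have dE : hell_dist s Sbar = d%:E by rewrite fineK.
have d0 : 0 <= d by rewrite fine_ge0// hell_dist_ge0.
(* The distance to the model need not be attained. Two approximations, each with error [1], lead to
   a point of [S]; the constants they cost are absorbed by [1 <= pen]. *)
have [u Sbaru su] : exists2 u, Sbar u & hell s u < d + 1.
  have : (hell_dist s Sbar < (d + 1)%:E)%E by rewrite dE lte_fin ltrDl.
  by move=> /ereal_inf_lt[_ [u Su <-]]; rewrite lte_fin; exists u.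
have [sbar Ssbar us] := dense u Sbaru 1 ltr01.
have sbar_le : hell2 s sbar <= 4 * d ^+ 2 + 6.
  apply: le_trans (hell2_triangle s u sbar) _; rewrite -!sqr_hell.
  have := hell_ge0 s u; have := hell_ge0 u sbar; move: su us.
  move: (hell s u) (hell u sbar) => x y xd y1 y0 x0.
  have H1 : x ^+ 2 <= (d + 1) ^+ 2.
    by rewrite lerXn2r ?nnegrE//; lra.
  have H2 : y ^+ 2 <= 1 by rewrite exprn_ile1// ltW.
  by have := sqr_ge0 (d - 1); move: H1; rewrite sqrrB sqrrD expr1n; lra.
have [gs Fgs gsP] := countable_shifts cS (ex_intro _ _ Ssbar) SSbar.
have [mE PE] := law_exp_deviation_le unimodal_q F_neq0 vcF n_gt0 s sbar xi l0 l1 Fgs.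
move: mE PE; set E := [set X | _] => mE PE.
apply: (le_trans PE); apply: le_measure; rewrite ?inE//.
  rewrite dE -[X in measurable X]setTI.
  have mh : measurable_fun setT (fun X => (20000^-1 * hell s (shat X) ^+ 2)%:E).
    apply/measurable_EFinP; apply: measurable_funM => //.
    exact: measurable_funX.
  under eq_set do rewrite -sqr_hell.
  exact: emeasurable_fun_infty_c.
move=> X EX; rewrite /mkset dE -EFin_expe -EFinD lee_fin ler_pdivrMl ?ltr0n//.
have TX u' : S u' -> stat_T X sbar u' <=
    2 * hell2 s sbar - 5^-1 * hell2 s u' + (3 * pen + xi) / lambda.
  move=> /gsP[k ->]; apply: stat_T_le => //.
  have := EX k; rewrite /exp_deviation ler_expR.
  by under eq_bigr do rewrite mul1r.
(* Distance zero to the near minimizers provides one of them at distance less than [1]. *)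
have [_ [t tmin <-]] : exists2 r, [set (hell (shat X) t)%:E | t in near_minimizers X S] r & (r < 1%:E)%E.
  by apply: ereal_inf_lt; rewrite -/(hell_dist _ _) hE lte_fin.
rewrite lte_fin => ht.
have tle := near_minimizer_le Ssbar TX tmin.
have h1 : hell2 (shat X) t <= 1 by rewrite -sqr_hell; apply: exprn_ile1; [exact: hell_ge0|exact: ltW].
have := hell2_triangle s t (shat X); rewrite [hell2 t _]hell2C => H.
move: tle; rewrite /lambda invrK => tle.
(* Altogether [h^2(s, shat) <= 160 d^2 + 599 + 4800 (3 pen + xi)], and [599 <= 599 * pen]. *)
have := sqr_ge0 d; lra.
Qed.

End rho_deviation.

(** * Continuity of translations in Hellinger distance *)

Section translation_continuity.
Context {R : realType}.
Local Notation mu := (@lebesgue_measure R).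
Local Notation T := (measurableTypeR R).

Lemma lebesgue_measure_shift (a : R) (A : set T) : measurable A ->
  pushforward mu (fun x : T => x - a : T) A = mu A.
Proof.
have ms : measurable_fun setT (fun x : T => x - a : T) by exact: measurable_funB.
move=> mA; apply/esym.
apply: (@lebesgue_measure_unique R (pushforward mu (fun x : T => x - a : T))) => //.
move=> _ [[x y]] _ <-.
have E : (fun z : T => z - a : T) @^-1` `]x, y]%classic = `](x + a), (y + a)]%classic.
  by apply/seteqP; split => z; rewrite /preimage/= !in_itv/= ltrBrDr lerBlDr.
transitivity (mu `](x + a), (y + a)]%classic); last by rewrite -E.
rewrite /= !lebesgue_measure_itv/= !lte_fin ltrD2r; case: ifPn => // _.
by rewrite -!EFinD opprD addrACA subrr addr0.
Qed.

Lemma expect_translate (q : density R) (a : R) (f : T -> R) :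
  bounded_measurable f ->
  expect (translate q a) f = expect q (fun y => f (y + a)).
Proof.
move=> bf; have [mf [M fM]] := bf.
have bfa : bounded_measurable (fun y : T => f (y + a) : R).
  split; last by exists M => x; exact: fM.
  apply: (measurableT_comp mf); exact: measurable_funD.
have ms : measurable_fun setT (fun x : T => x - a : T) by exact: measurable_funB.
rewrite /expect /Rintegral; congr fine.
rewrite -[RHS](@eq_measure_integral _ _ _ _ mu (pushforward mu (fun x : T => x - a : T))); last first.
  by move=> A mA _; exact: lebesgue_measure_shift.
rewrite integral_pushforward//=.
- by apply: eq_integral => x _; rewrite /= subrK.
- have := (integrable_mul_pdf q bfa).
  by case/integrableP.
- have -> : EFin \o (fun y : T => f (y + a) * q y) \o (fun x : T => x - a) =
    EFin \o (fun x => f x * translate q a x).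
    by apply/funext => x /=; rewrite subrK.
  exact: integrable_mul_pdf.
Qed.

Lemma bounded_measurable_indic (A : set T) : measurable A ->
  @bounded_measurable R (\1_A).
Proof.
move=> mA; split; first exact: measurable_indic.
by exists 1 => x; rewrite indicE; case: (_ \in _); rewrite ?normr0 ?normr1.
Qed.

Lemma expect_indic (q : density R) (A : set T) : measurable A ->
  (expect q (\1_A))%:E = density_prob q A.
Proof.
move=> mA; rewrite -integral_density_prob; last exact: bounded_measurable_indic.
by rewrite integral_indic// setIT.
Qed.

(** Factor [u - v] as a difference of squares: [|sqrt u - sqrt v|] is at most [sqrt u + sqrt v]. *)
Lemma h2_le_normr (u v : density R) :
  h2 u v <= 2^-1 * \int[mu]_x `|u x - v x|.
Proof.
rewrite /h2 ler_wpM2l//; apply: le_Rintegral => //; first exact: integrable_h2.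
  apply: (@integrable_le_pdf _ u v v _ 1).
    apply: measurableT_comp => //; apply: measurable_funB; exact: measurable_pdf.
  move=> x; rewrite normr_id mul1r.
  have := pdf_ge0 u x; have := pdf_ge0 v x => h1 h2.
  by rewrite ler_norml; lra.
move=> x _; have := pdf_ge0 u x; have := pdf_ge0 v x => v0 u0.
rewrite -{2}(sqr_sqrtr u0) -{2}(sqr_sqrtr v0) subr_sqr normrM expr2.
have a0 := sqrtr_ge0 (u x); have b0 := sqrtr_ge0 (v x).
rewrite (ger0_norm (addr_ge0 a0 b0)).
rewrite -[leLHS]ger0_norm -?expr2 ?sqr_ge0// expr2 normrM ler_wpM2l//.
by rewrite ler_norml; lra.
Qed.

Variables (q : density R) (m : R).
Hypothesis q_incr : {in `]-oo, m[ &, {homo q : x y / x <= y}}.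
Hypothesis q_decr : {in `]m, +oo[ &, {homo q : x y /~ x <= y}}.

Let itv d : set T := [set x | `|x - m| <= d].

Let measurable_mitv d : measurable (itv d).
Proof.
have -> : itv d = `[m - d, m + d]%classic.
  by apply/seteqP; split => x; rewrite /itv /= in_itv/= ler_distl.
exact: measurable_itv.
Qed.

(* By monotonicity on each side of the mode, [|q(x - a) - q(x - b)|] is at most
   [k1 x * q(x - a) + k2 x * q(x - b)] for signs [k1], [k2] which, once translated
   back, cancel away from the mode. *)
Lemma h2_translate_le (a b : R) : a <= b ->
  h2 (translate q a) (translate q b) <= expect q (\1_(itv (b - a))).
Proof.
move=> ab.
pose k1 x : R := if x <= m + b then 1 else -1.
pose k2 x : R := if m + a <= x then 1 else -1.
have bk1 : @bounded_measurable R k1.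
  split; last by exists 1 => x; rewrite /k1; case: ifP; rewrite ?normrN normr1.
  by apply: measurable_fun_ifT => //; exact: measurable_fun_ler.
have bk2 : @bounded_measurable R k2.
  split; last by exists 1 => x; rewrite /k2; case: ifP; rewrite ?normrN normr1.
  by apply: measurable_fun_ifT => //; exact: measurable_fun_ler.
apply: le_trans (h2_le_normr _ _) _; rewrite mulrC ler_pdivrMr//.
apply: (@le_trans _ _ (expect (translate q a) k1 + expect (translate q b) k2)).
  rewrite /expect -RintegralD//; [|exact: integrable_mul_pdf..].
  apply: le_Rintegral => //.
  - apply: (@integrable_le_pdf _ (translate q a) (translate q b) (translate q b) _ 1).
      apply: measurableT_comp => //; apply: measurable_funB; exact: measurable_pdf.
    move=> x; rewrite normr_id mul1r.
    have := pdf_ge0 (translate q a) x; have := pdf_ge0 (translate q b) x => h1 h2.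
    by rewrite ler_norml; lra.
  - by apply: integrable_EFinD; exact: integrable_mul_pdf.
  move=> x _; rewrite !translateE /k1 /k2.
  have qa := pdf_ge0 q (x - a); have qb := pdf_ge0 q (x - b).
  rewrite ler_norml.
  have [xb|bx] := leP x (m + b); have [ax|xa] := leP (m + a) x; last by lra.
  - by lra.
  - have : q (x - b) <= q (x - a) by apply: q_incr; rewrite ?in_itv/=; lra.
    by lra.
  - have : q (x - a) <= q (x - b) by apply: q_decr; rewrite ?in_itv/= ?andbT; lra.
    by lra.
rewrite !expect_translate// -expectD; last 2 first.
- by split; [apply: (measurableT_comp bk1.1); exact: measurable_funD|case: bk1 => _ [M H]; exists M => x; exact: H].
- by split; [apply: (measurableT_comp bk2.1); exact: measurable_funD|case: bk2 => _ [M H]; exists M => x; exact: H].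
rewrite mulrC -expectZ; last exact: bounded_measurable_indic.
apply: le_expect.
- apply: bounded_measurableD.
  by split; [apply: (measurableT_comp bk1.1); exact: measurable_funD|case: bk1 => _ [M H]; exists M => x; exact: H].
  by split; [apply: (measurableT_comp bk2.1); exact: measurable_funD|case: bk2 => _ [M H]; exists M => x; exact: H].
- exact/bounded_measurableZ/bounded_measurable_indic.
move=> y; rewrite /k1 /k2 indicE.
have -> : (y \in itv (b - a)) = (`|y - m| <= b - a).
  by apply/idP/idP; rewrite inE.
rewrite ler_norml.
have [yb|yb] := leP (y + a) (m + b); have [ya|ya] := leP (m + a) (y + b) => /=.
- by rewrite (_ : _ && _) ?mulr1//; apply/andP; split; lra.
- by rewrite (_ : _ && _ = false) ?mulr0; [lra|apply/negbTE/negP => /andP[]; lra].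
- by rewrite (_ : _ && _ = false) ?mulr0; [lra|apply/negbTE/negP => /andP[]; lra].
- lra.
Qed.

(** The bound of [h2_translate_le] is the mass near the mode, which tends to the mass of [{m}],
    namely zero, by continuity from above. It depends only on [b - a], hence the uniformity. *)
Lemma h2_translate_small (eps : R) : 0 < eps -> exists2 d : R, 0 < d &
  forall a b, `|a - b| <= d -> h2 (translate q a) (translate q b) <= eps.
Proof.
move=> e0.
pose I k := itv k.+1%:R^-1.
have dI0 : density_prob q (\bigcap_k I k) = 0%E.
  have -> : \bigcap_k I k = [set m].
    apply/seteqP; split => [x xI|x -> k _]; last first.
      by rewrite /I /itv /= subrr normr0 invr_ge0.
    apply/eqP; rewrite -subr_eq0 -normr_le0; apply/ler_addgt0Pl => e e_gt0.
    rewrite addr0; have [k ke] := ltr_add_invr e_gt0.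
    rewrite add0r in ke; exact: (le_trans (xI k Logic.I) (ltW ke)).
  apply: null_set_integral => //; last exact: lebesgue_measure_set1.
  by apply/measurable_funTS/measurable_EFinP; exact: measurable_pdf.
have cvgI : density_prob q \o I @ \oo --> density_prob q (\bigcap_k I k).
  apply: nonincreasing_cvg_mu.
  - by apply: (@le_lt_trans _ _ 1%E); [exact: (probability_le1 (density_prob q) (measurable_mitv _))|exact: ltry].
  - by move=> k; exact: measurable_mitv.
  - by apply: bigcapT_measurable => k; exact: measurable_mitv.
  - move=> j k jk; apply/subsetPset => x; rewrite /I /itv/= => /le_trans; apply.
    by rewrite lef_pV2 ?posrE ?ltr0n// ler_nat.
rewrite dI0 in cvgI.
have [k kE] : exists k, (density_prob q (I k) < eps%:E)%E.
  apply: contrapT => noI.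
  have : (eps%:E <= 0)%E.
    apply: cvge_ge cvgI; apply: nearW => k; rewrite /= leNgt; apply/negP => kE.
    by apply: noI; exists k.
  by rewrite lee_fin leNgt e0.
exists k.+1%:R^-1; first by rewrite invr_gt0.
suff H a b : a <= b -> `|a - b| <= k.+1%:R^-1 -> h2 (translate q a) (translate q b) <= eps.
  move=> a b abk; have [ab|/ltW ba] := leP a b; first exact: H.
  by rewrite h2C; apply: H => //; rewrite distrC.
move=> ab; rewrite distrC ger0_norm ?subr_ge0// => abk.
apply: le_trans (h2_translate_le ab) _.
rewrite -lee_fin; apply: le_trans (ltW kE); rewrite -expect_indic ?lee_fin; last exact: measurable_mitv.
apply: le_expect; [exact: (bounded_measurable_indic (measurable_mitv _))..|].
move=> x; rewrite !indicE ler_nat; case: (boolP (x \in itv _)) => //.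
rewrite inE => xi; rewrite mem_set//.
exact: (le_trans xi).
Qed.

End translation_continuity.

(** * The uniform dimension *)

Section integral_monotonicity.
Import HBNNSimple.

(* Unlike [ge0_le_integral], without measurability of the functions. *)
Lemma ge0_le_integral_sub d (T : measurableType d) (R : realType)
    (mu : {measure set T -> \bar R}) (f g : T -> \bar R) :
  (forall x, 0 <= f x)%E -> (forall x, f x <= g x)%E ->
  (\int[mu]_x f x <= \int[mu]_x g x)%E.
Proof.
move=> f0 fg; have g0 x : (0 <= g x)%E by exact: le_trans (f0 x) (fg x).
rewrite !ge0_integralTE//; apply: ereal_sup_le => _ [h hf <-].
by exists h => // x; exact: le_trans (hf x) (fg x).
Qed.

End integral_monotonicity.

(** * Countable nets of the model *)

Section net.
Context {R : realType} {n : nat}.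
Variables (q : density R) (F : set 'rV[R]_n).
Hypothesis unimodal_q : unimodal q.
Hypothesis F_neq0 : F !=set0.
Hypothesis n_gt0 : (0 < n)%N.
Local Notation Sbar := (shift_model q F).

(** Cut the parameter space into cubes of side [d], indexed by integer vectors, and keep one point
    of [F] per occupied cube. The side makes each coordinate contribute at most [1 / n]. *)
Lemma exists_countable_net : exists S0 : set (L0 R n),
  [/\ countable S0, S0 `<=` Sbar &
      forall u, Sbar u -> exists2 t, S0 t & hell2 u t <= 1].
Proof.
have [m [incr decr]] := unimodal_q.
have n0 : 0 < n%:R^-1 :> R by rewrite invr_gt0 ltr0n.
have [d d0 hd] := h2_translate_small incr decr n0.
have [g0 Fg0] := F_neq0.
pose cell (g : 'rV[R]_n) : 'rV[int]_n := \row_i Num.floor (g ord0 i / d).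
have /choice[g gP] : forall z, exists g, F g /\
    forall g', F g' -> cell g' = z -> cell g = z.
  move=> z; have [[g [Fg gz]]|no] := pselect (exists g, F g /\ cell g = z).
    by exists g.
  by exists g0; split => // g' Fg' g'z; exfalso; apply: no; exists g'.
exists (range (fun z => shifts q (g z))); split.
- apply: card_le_trans (card_image_le _ _) _; exact: countableP.
- by move=> _ [z _ <-]; exists (g z) => //; case: (gP z).
move=> _ [g' Fg' <-]; exists (shifts q (g (cell g'))); first by exists (cell g').
have [_ /(_ g' Fg' erefl) cE] := gP (cell g').
apply: (@le_trans _ _ (\sum_(i < n) n%:R^-1)).
  apply: ler_sum => i _; apply: hd.
  have : cell (g (cell g')) ord0 i = cell g' ord0 i by rewrite cE.
  rewrite !mxE => fE.
  have := floor_itv (g (cell g') ord0 i / d); rewrite fE => /andP[].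
  have /andP[] := floor_itv (g' ord0 i / d).
  move: (Num.floor _) => z; rewrite !ler_pdivlMr// !ltr_pdivrMr// intrD mulrDl mul1r.
  by rewrite ler_norml; lra.
by rewrite sumr_const card_ord -[leLHS]mulr_natl divff// pnatr_eq0 -lt0n.
Qed.

(** Distinct points of the net may be at distance zero, so one representative is kept for each class
    of such points; [hell2_triangle] then doubles the radius. *)
Lemma exists_identifiable_net : exists S : set (L0 R n),
  [/\ countable S, identifiable S, S !=set0, S `<=` Sbar &
      forall u, Sbar u -> exists2 t, S t & hell2 u t <= 2].
Proof.
have [S0 [cS0 S0Sbar netS0]] := exists_countable_net.
have [g0 Fg0] := F_neq0.
(* [r] depends only on the set, so two points with the same class get the same representative. *)
have /choice[r rP] : forall A : set (L0 R n), exists t, A !=set0 -> A t.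
  move=> A; have [[t At]|A0] := pselect (A !=set0); first by exists t.
  by exists (shifts q g0).
pose cl t := [set u | S0 u /\ hell2 t u = 0].
have hell2xx (t : L0 R n) : hell2 t t = 0.
  by apply: big1 => i _; rewrite /h2 /Rintegral integral0_eq ?mulr0// => x _; rewrite subrr expr0n.
have clP t : S0 t -> S0 (r (cl t)) /\ hell2 t (r (cl t)) = 0.
  by move=> S0t; apply: (rP (cl t)); exists t.
have tr (t u v : L0 R n) : hell2 t u = 0 -> hell2 u v = 0 -> hell2 t v = 0.
  move=> tu uv; apply/eqP; rewrite eq_le hell2_ge0 andbT.
  by rewrite (le_trans (hell2_triangle t u v))// tu uv !mulr0 addr0.
exists ((fun t => r (cl t)) @` S0); split.
- exact: card_le_trans (card_image_le _ _) cS0.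
- move=> _ _ [t S0t <-] [u S0u <-] ne; rewrite lt_neqAle hell_ge0 andbT eq_sym.
  apply/eqP => h0; apply: ne; congr r.
  have [_ tr0] := clP _ S0t; have [_ ur0] := clP _ S0u.
  have tu : hell2 t u = 0.
    apply: (tr _ _ _ tr0); apply: (tr _ (r (cl u))); last by rewrite hell2C.
    by rewrite -sqr_hell h0 expr0n.
  have ut : hell2 u t = 0 by rewrite hell2C.
  by apply/seteqP; split => v [S0v h]; (split; first exact: S0v);
    [exact: (tr _ _ _ ut h)|exact: (tr _ _ _ tu h)].
- have [t S0t _] := netS0 (shifts q g0) (ex_intro2 _ _ g0 Fg0 erefl).
  by exists (r (cl t)), t.
- by move=> _ [t S0t <-]; apply: S0Sbar; case: (clP t S0t).
move=> u /netS0[t S0t ut]; exists (r (cl t)); first by exists t.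
have [_ tr0] := clP _ S0t.
by apply: le_trans (hell2_triangle u t _) _; rewrite tr0; lra.
Qed.

End net.

(** * Modulus of the empirical process *)

Section uniform_dimension.
Context {R : realType} {n V : nat}.
Local Notation T := (measurableTypeR R).
Local Notation sample := (n.-tuple T).
Variables (q : density R) (F : set 'rV[R]_n).
Hypothesis unimodal_q : unimodal q.
Hypothesis F_neq0 : F !=set0.
Hypothesis vcF : vc_subgraph (as_functions F) V.
Hypothesis n_gt0 : (0 < n)%N.
Local Notation pen := (@penalty R n V).
Local Notation Sbar := (shift_model q F).
Local Notation c0 := (@c0 R).

Let dev s sbar sigma lambda (gs : nat -> 'rV[R]_n) X :=
  ereal_sup (range (fun j => (exp_deviation q s sbar sigma lambda (gs j) X)%:E)).

(** The inequality [1 + x <= expR x], with [x] the exponent of [exp_deviation] minus [3 * pen],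
    bounds [Z] linearly in the exponential deviation. The two signs give the absolute value, and the
    variances sum to at most [6 * y ^+ 2]. *)
Lemma process_Z_le (s sbar : L0 R n) (lambda y : R) (gs : nat -> 'rV[R]_n) k
    (X : sample) : 0 < lambda ->
  hell2 s (shifts q (gs k)) + hell2 s sbar <= y ^+ 2 ->
  (`|process_Z s X sbar (shifts q (gs k))|%:E <=
   (24 * lambda * y ^+ 2 + 3 * pen / lambda)%:E +
   (expR (- (3 * pen)) / lambda)%:E *
     (dev s sbar 1 lambda gs X + dev s sbar (-1) lambda gs X))%E.
Proof.
move=> l0 hy; set t := shifts q (gs k).
have bp i := bounded_measurable_psi_ratio (t i) (sbar i).
pose Z := \sum_(i < n) (psi_ratio (t i (tnth X i)) (sbar i (tnth X i))
      - expect (s i) (fun x => psi_ratio (t i x) (sbar i x))).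
have -> : process_Z s X sbar t = Z.
  apply: eq_bigr => i _; rewrite psi_sqrt_ratioE; congr (_ - _).
  rewrite unlock /expectation.
  under eq_integral do rewrite psi_sqrt_ratioE.
  by rewrite (integral_law_coord s i (bp i)).
pose E2 := \sum_(i < n) expect (s i) (fun x => psi_ratio (t i x) (sbar i x) ^+ 2).
have E2y : E2 <= 6 * y ^+ 2.
  apply: (@le_trans _ _ (\sum_(i < n) (6 * h2 (s i) (sbar i) + 6 * h2 (s i) (t i)))).
    by apply: ler_sum => i _; exact: expect_sqr_psi_ratio_le.
  have -> : \sum_(i < n) (6 * h2 (s i) (sbar i) + 6 * h2 (s i) (t i)) =
    6 * hell2 s sbar + 6 * hell2 s t by rewrite /hell2 !mulr_sumr -big_split.
  by rewrite /t; lra.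
have devE sigma : exp_deviation q s sbar sigma lambda (gs k) X =
    expR (lambda * (sigma * Z) - 4 * lambda ^+ 2 * E2).
  rewrite /exp_deviation; congr expR.
  by rewrite /Z /E2 !mulr_sumr -sumrB; apply: eq_bigr => i _.
have key sigma : lambda * (sigma * Z) <=
    24 * lambda ^+ 2 * y ^+ 2 + 3 * pen + expR (- (3 * pen)) * exp_deviation q s sbar sigma lambda (gs k) X.
  rewrite devE -expRD.
  have := expR_ge1Dx (- (3 * pen) + (lambda * (sigma * Z) - 4 * lambda ^+ 2 * E2)).
  have l2 : 0 < 4 * lambda ^+ 2 by rewrite mulr_gt0// exprn_gt0.
  have := E2y; rewrite -(ler_pM2l l2); lra.
have U sigma : ((exp_deviation q s sbar sigma lambda (gs k) X)%:E <= dev s sbar sigma lambda gs X)%E.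
  by apply: ereal_sup_ubound; exists k.
set e1 := exp_deviation q s sbar 1 lambda (gs k) X.
set e2 := exp_deviation q s sbar (-1) lambda (gs k) X.
have e10 : 0 <= e1 by exact: expR_ge0.
have e20 : 0 <= e2 by exact: expR_ge0.
have p0 : 0 < expR (- (3 * pen)) :> R by exact: expR_gt0.
apply: (@le_trans _ _ ((24 * lambda * y ^+ 2 + 3 * pen / lambda)%:E +
   (expR (- (3 * pen)) / lambda)%:E * (e1 + e2)%:E)%E); last first.
  rewrite leeD2l// lee_pmul2l ?lte_fin ?divr_gt0// EFinD.
  by apply: leeD; exact: U.
rewrite -EFinM -EFinD lee_fin -(ler_pM2l l0).
have -> : lambda * (24 * lambda * y ^+ 2 + 3 * pen / lambda +
    expR (- (3 * pen)) / lambda * (e1 + e2)) =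
    24 * lambda ^+ 2 * y ^+ 2 + 3 * pen + expR (- (3 * pen)) * e1
     + expR (- (3 * pen)) * e2.
  by field; rewrite gt_eqF.
have k1 := key 1; have k2 := key (-1).
rewrite -/e1 mul1r in k1; rewrite -/e2 mulN1r in k2.
have := mulr_ge0 (ltW p0) e10; have := mulr_ge0 (ltW p0) e20.
have [Z0|Z0] := ger0P Z; lra.
Qed.

(** The factor [expR (- (3 * pen))] cancels the means of the two suprema, leaving [2 / lambda], and
    [3 * pen + 2 <= 5 * pen]. *)
Lemma modulus_w_le (S : set (L0 R n)) (s sbar : L0 R n) (lambda y : R) :
  countable S -> S !=set0 -> S `<=` Sbar -> 0 < lambda -> lambda <= 36^-1 ->
  (modulus_w S s sbar y <= (24 * lambda * y ^+ 2 + 5 * pen / lambda)%:E)%E.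
Proof.
move=> cS S0 SSbar l0 l1.
have [gs Fgs gsP] := countable_shifts cS S0 SSbar.
have pen1 : 1 <= pen := penalty_ge1 F_neq0 vcF.
have mdev sigma : measurable_fun setT (dev s sbar sigma lambda gs).
  apply: measurable_ereal_sup_range => k; apply/measurable_EFinP.
  exact: measurable_exp_deviation.
have dev0 sigma X : (0 <= dev s sbar sigma lambda gs X)%E.
  apply: (@le_trans _ _ (exp_deviation q s sbar sigma lambda (gs 0%N) X)%:E).
    by rewrite lee_fin expR_ge0.
  by apply: ereal_sup_ubound; exists 0%N.
have A0 : 0 <= 24 * lambda * y ^+ 2 + 3 * pen / lambda.
  apply: addr_ge0; first by apply: mulr_ge0; [lra|exact: sqr_ge0].
  by apply: divr_ge0; lra.
have c0 : 0 <= expR (- (3 * pen)) / lambda by rewrite divr_ge0 ?expR_ge0// ltW.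
apply: (@le_trans _ _ (\int[law s]_X ((24 * lambda * y ^+ 2 + 3 * pen / lambda)%:E +
   (expR (- (3 * pen)) / lambda)%:E *
     (dev s sbar 1 lambda gs X + dev s sbar (-1) lambda gs X)))%E).
  apply: ge0_le_integral_sub => X.
    by apply: ereal_sup_ubound; left.
  apply: ub_ereal_sup => _ [->|[t [St ht] <-]].
    by rewrite adde_ge0 ?lee_fin// mule_ge0 ?lee_fin// adde_ge0.
  have [k tE] := (gsP t).1 St; rewrite tE in ht *.
  exact: process_Z_le.
have m2 : measurable_fun setT (fun X => (dev s sbar 1 lambda gs X + dev s sbar (-1) lambda gs X)%E).
  exact: emeasurable_funD.
rewrite ge0_integralD//=; last 2 first.
- by move=> X _; rewrite mule_ge0 ?lee_fin// adde_ge0.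
- exact: measurable_funeM.
rewrite integral_cst//= probability_setT mule1 ge0_integralZl_EFin//; last first.
  by move=> X _; rewrite adde_ge0.
rewrite ge0_integralD//.
have s1 : 1 ^+ 2 = 1 :> R by rewrite expr1n.
have sN1 : (-1) ^+ 2 = 1 :> R by rewrite sqrrN expr1n.
have I1 := integral_sup_exp_deviation_le unimodal_q F_neq0 vcF n_gt0 s sbar s1 l0 l1 Fgs.
have I2 := integral_sup_exp_deviation_le unimodal_q F_neq0 vcF n_gt0 s sbar sN1 l0 l1 Fgs.
apply: (@le_trans _ _ ((24 * lambda * y ^+ 2 + 3 * pen / lambda)%:E +
   (expR (- (3 * pen)) / lambda)%:E * (expR (3 * pen) + expR (3 * pen))%:E)%E).
  apply: leeD2l; apply: lee_wpmul2l; first by rewrite lee_fin.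
  by rewrite EFinD; exact: (leeD I1 I2).
rewrite -EFinM -EFinD lee_fin.
have -> : expR (- (3 * pen)) / lambda * (expR (3 * pen) + expR (3 * pen)) = 2 / lambda.
  transitivity (expR (3 * pen) * expR (- (3 * pen)) * (2 / lambda)); first by ring.
  by rewrite expRxMexpNx_1 mul1r.
rewrite -addrA lerD2l -mulrDl ler_pM2r ?invr_gt0//; lra.
Qed.

End uniform_dimension.

Lemma sqre_le (R : realType) (x : \bar R) (r : R) : (0 <= x)%E -> 0 <= r ->
  (x <= (Num.sqrt r)%:E)%E -> (x ^+ 2 <= r%:E)%E.
Proof.
move=> + r0; case: x => [x| |]; [|by rewrite leye_eq|by rewrite leeNy_eq].
move=> x0 xr; rewrite -EFin_expe lee_fin; rewrite !lee_fin in x0 xr.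
rewrite -(sqr_sqrtr r0).
by rewrite lerXn2r ?nnegrE ?sqrtr_ge0.
Qed.

Section dimension_bound.
Context {R : realType} {n V : nat}.
Variables (q : density R) (F : set 'rV[R]_n).
Hypothesis unimodal_q : unimodal q.
Hypothesis F_neq0 : F !=set0.
Hypothesis vcF : vc_subgraph (as_functions F) V.
Hypothesis n_gt0 : (0 < n)%N.
Local Notation pen := (@penalty R n V).
Local Notation Sbar := (shift_model q F).
Local Notation c0 := (@c0 R).
Local Notation B := (480 / c0 ^+ 2).

Lemma c0_bounds : 0 < c0 <= 8^-1.
Proof.
rewrite /c0; have := @sqrt2V_gt0 R; have := @sqrt2V_lt R.
move: (_^-1 : R) => w; lra.
Qed.

(** With [lambda = c0 / 48] the quadratic term of [modulus_w_le] is [c0 * y^2 / 2], half of the left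
    side of the defining inequality. Hence [y^2 <= 480 * pen / c0^2]. *)
Lemma dimension_at_le (S : set (L0 R n)) (s sbar : L0 R n) :
  countable S -> S !=set0 -> S `<=` Sbar ->
  (dimension_at S s sbar <= (B * pen)%:E)%E.
Proof.
move=> cS S0 SSbar; have /andP[c00 c08] := c0_bounds.
have pen1 : 1 <= pen := penalty_ge1 F_neq0 vcF.
have c02 : 0 < c0 ^+ 2 by rewrite exprn_gt0.
have B1 : 1 <= B.
  have c01 : c0 ^+ 2 <= 1 by apply: exprn_ile1; lra.
  by rewrite ler_pdivlMr//; lra.
have Bpen1 : 1 <= B * pen by nra.
have yP y : 0 <= y -> ((c0 * y ^+ 2)%:E < modulus_w S s sbar y)%E ->
    y ^+ 2 <= B * pen.
  move=> y0; pose lambda := c0 / 48.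
  have l0 : 0 < lambda by rewrite divr_gt0// ltr0n.
  have l1 : lambda <= 36^-1.
    by rewrite /lambda; lra.
  move=> /lt_le_trans/(_ (modulus_w_le unimodal_q F_neq0 vcF n_gt0 s sbar y
    cS S0 SSbar l0 l1)).
  rewrite lte_fin /lambda => H.
  have E : 5 * pen / (c0 / 48) = c0 / 2 * (B * pen).
    by field; rewrite gt_eqF.
  rewrite E in H; rewrite -(ler_pM2l (_ : 0 < c0 / 2)); last by lra.
  by lra.
rewrite /dimension_at ge_max; apply/andP; split; last by rewrite lee_fin.
apply: sqre_le; [by apply: ereal_sup_ubound; left|lra|].
apply: ub_ereal_sup => _ [->|[y [y0 yw] <-]]; first by rewrite lee_fin sqrtr_ge0.
rewrite lee_fin -[y]ger0_norm// -sqrtr_sqr ler_sqrt; last by lra.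
exact: yP.
Qed.

Lemma uniform_dim_le :
  (uniform_dim Sbar <= ((4 * c1 R + c2 R * B) * pen)%:E)%E.
Proof.
have pen1 : 1 <= pen := penalty_ge1 F_neq0 vcF.
have [S [cS iS S0 SSbar netS]] := exists_identifiable_net unimodal_q F_neq0 n_gt0.
have c1_ge0 : 0 <= c1 R.
  by rewrite /c1 mulr_ge0// addr_ge0// mulr_ge0.
have c2_ge0 : 0 <= c2 R by rewrite /c2 addr_ge0// invr_ge0.
apply: (@le_trans _ _ ((2 * c1 R)%:E * esup0 [set hell_dist u S ^+ 2 | u in Sbar]
                 + (c2 R)%:E * Dbar_countable S)%E).
  by apply: ereal_inf_lbound; exists S.
(* The net has squared radius [2], whence the term [4 * c1]; it is multiplied by [pen >= 1] at the
   end. *)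
apply: (@le_trans _ _ ((2 * c1 R)%:E * 2%:E + (c2 R)%:E * (B * pen)%:E)%E).
  apply: leeD; apply: lee_wpmul2l; rewrite ?lee_fin ?mulr_ge0//.
    apply: ub_ereal_sup => _ [->|[u Su <-]]; first by rewrite lee_fin.
    apply: sqre_le => //; first exact: hell_dist_ge0.
    have [t St ut] := netS u Su.
    apply: (@le_trans _ _ (hell u t)%:E).
      by apply: ereal_inf_lbound; exists t.
    by rewrite lee_fin ler_sqrt.
  by apply: ub_ereal_sup => _ [[s sbar] _ <-]; exact: dimension_at_le.
rewrite -!EFinM -EFinD lee_fin; nra.
Qed.

End dimension_bound.

Theorem theorem25 (R : realType) :
  exists Cstar C : R, 0 < Cstar /\ 0 < C /\
  forall (n : nat) (q : density R) (F : set 'rV[R]_n) (V : nat),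
    (3 <= n)%N -> unimodal q -> F !=set0 -> vc_subgraph (as_functions F) V ->
    let Sbar := shift_model q F in
    let penalty := V%:R * (1 + log_plus (n%:R / V%:R)) in
    (uniform_dim Sbar <= (Cstar * penalty)%:E)%E /\
    forall (S : set (L0 R n)) (shat : n.-tuple (measurableTypeR R) -> L0 R n),
      dense_in S Sbar -> rho_estimator S shat ->
      forall (p : density R) (f : 'rV[R]_n) (xi : R), 0 < xi ->
        ((1 - expR (- xi))%:E <=
         law (shifts p f)
           [set X | (C * hell2 (shifts p f) (shat X))%:E <=
                    hell_dist (shifts p f) Sbar ^+ 2 + (penalty + xi)%:E])%E.
Proof.
have /andP[c00 _] := @c0_bounds R.
exists (4 * c1 R + c2 R * (480 / (c0 R) ^+ 2)), 20000^-1; split.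
  apply: addr_gt0; apply: mulr_gt0.
  - by rewrite ltr0n.
  - by rewrite /c1; have := @sqrtr_ge0 R 2; lra.
  - by rewrite /c2; have := @sqrt2V_gt0 R; lra.
  - by rewrite divr_gt0 ?exprn_gt0 ?ltr0n.
split; first by rewrite invr_gt0 ltr0n.
move=> n q F V n3 uq F0 vcF Sbar penalty; have n0 : (0 < n)%N by exact: leq_trans n3.
split; first exact: uniform_dim_le.
move=> S shat dS rS p f xi xi0.
exact: (rho_estimator_deviation uq F0 vcF n0 (shifts p f) dS rS xi0).
Qed.
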